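(* Let $\ell\ge 1$ and $0\le r\le \ell$, and let $W(\Lambda_r)=U(\tilde{\mathfrak g}_1)\cdot v_r\subset L(\Lambda_r)$ be the Feigin-Stoyanovsky's type subspace of the level $1$ standard $\tilde{\mathfrak{sl}}_{\ell+1}(\mathbb C)$-module $L(\Lambda_r)$. Let $\mathcal B$ be the set of monomial vectors $b\,v_r$, where $$b=x_\ell(-m_{\ell,n_\ell})\cdots x_\ell(-m_{\ell,1})\cdots x_1(-m_{1,n_1})\cdots x_1(-m_{1,1}),\qquad n_i\ge 0,\quad m_{i,n+1}\ge m_{i,n}>0,$$ ranges over all monomials satisfying the initial conditions $$m_{j,n}\;\ge\; 1+\sum_{i<j} n_i+\delta_{j\le r},\qquad 1\le j\le \ell,\ 1\le n\le n_j,$$ and the difference conditions $$m_{j,n+1}\ge m_{j,n}+2,\qquad 1\le j\le \ell,\ 1\le n\le n_j-1.$$ Then $\mathcal B$ is a basis of $W(\Lambda_r)$ (where $\mathcal B$ is indexed by the monomials $b$).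
   Context: Let $\mathfrak g=\mathfrak{sl}_{\ell+1}(\mathbb C)$ with Cartan subalgebra $\mathfrak h$, root system $R$, basis of simple roots $\{\alpha_1,\dots,\alpha_\ell\}$ (in the standard numbering of type $A_\ell$), fundamental weights $\omega_1,\dots,\omega_\ell$, $\omega_0=0$, and normalized invariant bilinear form $\langle\cdot,\cdot\rangle$. For each root $\alpha$ a nonzero root vector $x_\alpha\in\mathfrak g_\alpha$ is fixed. The affine Lie algebra is $\tilde{\mathfrak g}=\tilde{\mathfrak{sl}}_{\ell+1}(\mathbb C)=\mathfrak g\otimes\mathbb C[t,t^{-1}]\oplus\mathbb C c\oplus\mathbb C d$, the usual untwisted affine algebra: writing $x(m)=x\otimes t^m$, one has $[x(m),y(n)]=[x,y](m+n)+m\,\delta_{m+n,0}\langle x,y\rangle c$, $c$ is central, $[d,x(m)]=m\,x(m)$. Its fundamental weights are $\Lambda_0,\dots,\Lambda_\ell$. $L(\Lambda_r)$ is the standard (integrable irreducible highest weight) $\tilde{\mathfrak g}$-module of level $1$ with highest weight $\Lambda_r$, and $v_r$ is its highest weight vector. Set $\gamma_i=\alpha_i+\dots+\alpha_\ell$ for $i=1,\dots,\ell$; these are exactly the roots $\alpha$ with $\langle\alpha,\omega_\ell\rangle=1$. Let $\mathfrak g_1=\sum_{i=1}^\ell\mathfrak g_{\gamma_i}$ and $\tilde{\mathfrak g}_1=\mathfrak g_1\otimes\mathbb C[t,t^{-1}]$, a commutative subalgebra of $\tilde{\mathfrak g}$. Write $x_i(m)=x_{\gamma_i}(m)$. The Feigin-Stoyanovsky's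 type subspace is $W(\Lambda_r)=U(\tilde{\mathfrak g}_1)\cdot v_r$. $\delta_{j\le r}$ equals $1$ if $j\le r$ and $0$ otherwise. In a monomial $b$, $n_i$ is the number of factors of the form $x_i(\cdot)$; $n_i=0$ means there are none, and the empty monomial ($b=1$) is allowed. *)

(* Defs.v *)
From HB Require Import structures.
From mathcomp Require Import all_boot all_order all_algebra.
From mathcomp Require Import boolp classical_sets functions cardinality fsbigop.
From mathcomp Require Import reals.
From mathcomp.real_closed Require Import complex.

Set Implicit Arguments.
Unset Strict Implicit.
Unset Printing Implicit Defensive.

Import Order.TTheory GRing.Theory Num.Theory.
Local Open Scope classical_set_scope.
Local Open Scope ring_scope.

Section LinearSpan.
Variables (F : fieldType) (V : lmodType F) (I : choiceType).

Definition lin_span (P : set I) (e : I -> V) : set V :=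
  [set u | exists (s : seq I) (c : I -> F),
     (forall i, i \in s -> P i) /\ u = \sum_(i <- s) c i *: e i].

Definition lin_indep (P : set I) (e : I -> V) : Prop :=
  forall (s : seq I) (c : I -> F), uniq s -> (forall i, i \in s -> P i) ->
    \sum_(i <- s) c i *: e i = 0 -> forall i, i \in s -> c i = 0.

(* The family [e], indexed by [P], is a basis of [W]. Distinct indices count
   as distinct members of the family. *)
Definition is_basis_of (P : set I) (e : I -> V) (W : set V) : Prop :=
  lin_indep P e /\ lin_span P e = W.

End LinearSpan.

Section SpecialLinear.
Variables (F : fieldType) (l : nat).

Definition traceless : {pred 'M[F]_l.+1} := fun A => \tr A == 0.

Fact traceless_submod : submod_closed traceless.
Proof.
split=> [|a A B]; rewrite !unfold_in; first by rewrite mxtrace0.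
by move=> /eqP A0 /eqP B0; rewrite mxtraceD mxtraceZ A0 B0 mulr0 addr0.
Qed.

HB.instance Definition _ :=
  GRing.isSubmodClosed.Build F 'M[F]_l.+1 traceless traceless_submod.

(* sl_(l+1)(F), of rank l *)
Record sl : Type := Sl { sl_mx : 'M[F]_l.+1; _ : sl_mx \in traceless }.

HB.instance Definition _ := [isSub for sl_mx].
HB.instance Definition _ := [Choice of sl by <:].
HB.instance Definition _ := [SubChoice_isSubLmodule of sl by <:].

Fact sl_bracket_subproof (x y : sl) :
  sl_mx x *m sl_mx y - sl_mx y *m sl_mx x \in traceless.
Proof. by rewrite unfold_in raddfB /= mxtrace_mulC subrr. Qed.

Definition sl_bracket (x y : sl) : sl := Sl (sl_bracket_subproof x y).

(* The invariant form, normalized by <theta, theta> = 2. *)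
Definition sl_form (x y : sl) : F := \tr (sl_mx x *m sl_mx y).

(* [sl_of_mx A] is the matrix [A] when [\tr A = 0], and 0 otherwise. *)
Definition sl_of_mx (A : 'M[F]_l.+1) : sl := insubd (0 : sl) A.

Lemma sl_of_mxK (A : 'M[F]_l.+1) : \tr A = 0 -> sl_mx (sl_of_mx A) = A.
Proof. by move=> /eqP A0; exact: (insubdK (0 : sl)). Qed.

Definition cartan : set sl := [set h | is_diag_mx (sl_mx h)].

(* The indices [lo i] and [hi i] of the matrix entries attached to the simple
   root alpha_(i+1): the 0-based [i : 'I_l] stands for i+1 in {1, .., l}. *)
Definition lo (i : 'I_l) : 'I_l.+1 := widen_ord (leqnSn l) i.
Definition hi (i : 'I_l) : 'I_l.+1 := lift ord0 i.

Definition alpha (i : 'I_l) (h : sl) : F :=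
  sl_mx h (lo i) (lo i) - sl_mx h (hi i) (hi i).

(* gamma_i = alpha_i + ... + alpha_l *)
Definition gamma (i : 'I_l) (h : sl) : F := \sum_(k < l | (i <= k)%N) alpha k h.

Definition root_space (a : sl -> F) : set sl :=
  [set x | forall h, cartan h -> sl_bracket h x = a h *: x].

Definition g1 : set sl :=
  [set y | exists z : 'I_l -> sl,
     (forall i, root_space (gamma i) (z i)) /\ y = \sum_i z i].

(* omega_r = eps_1 + .. + eps_r on h, hence omega_0 = 0. *)
Definition omega (r : nat) (h : sl) : F :=
  \sum_(k < l.+1 | (k < r)%N) sl_mx h k k.

Definition simple_coroot (i : 'I_l) : sl :=
  sl_of_mx (delta_mx (lo i) (lo i) - delta_mx (hi i) (hi i)).

Definition theta_coroot : sl :=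
  sl_of_mx (delta_mx ord0 ord0 - delta_mx ord_max ord_max).

Fact mxtrace_delta (i j : 'I_l.+1) :
  \tr (delta_mx i j : 'M[F]_l.+1) = (i == j)%:R.
Proof.
rewrite /mxtrace (bigD1 i)//= big1 => [|k /negPf ki]; rewrite mxE ?ki//.
by rewrite eqxx addr0.
Qed.

Fact simple_corootK (i : 'I_l) : sl_mx (simple_coroot i) =
  delta_mx (lo i) (lo i) - delta_mx (hi i) (hi i).
Proof. by rewrite sl_of_mxK// raddfB /= !mxtrace_delta !eqxx subrr. Qed.

Fact theta_corootK :
  sl_mx theta_coroot = delta_mx ord0 ord0 - delta_mx ord_max ord_max.
Proof. by rewrite sl_of_mxK// raddfB /= !mxtrace_delta !eqxx subrr. Qed.

Fact sl_deltaK (i j : 'I_l.+1) : i != j ->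
  sl_mx (sl_of_mx (delta_mx i j)) = delta_mx i j.
Proof.
by move=> /negPf ij; rewrite sl_of_mxK// mxtrace_delta ij.
Qed.

Fact omega_delta (r : nat) (i j : 'I_l.+1) (h : sl) :
  sl_mx h = delta_mx i i - delta_mx j j ->
  omega r h = (i < r)%:R - (j < r)%:R.
Proof.
have E k : \sum_(n < l.+1 | (n < r)%N) (delta_mx k k : 'M[F]_l.+1) n n = (k < r)%:R.
  rewrite big_mkcond (bigD1 k)//= big1 => [|n /negPf nk].
    by rewrite addr0 mxE !eqxx; case: ifP.
  by rewrite mxE nk if_same.
by rewrite /omega => ->; rewrite -!E -sumrB; apply: eq_bigr => n _; rewrite !mxE.
Qed.

Lemma sl_bracket_delta (i j : 'I_l.+1) : i != j ->
  sl_bracket (sl_of_mx (delta_mx i j)) (sl_of_mx (delta_mx j i)) =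
  sl_of_mx (delta_mx i i - delta_mx j j).
Proof.
move=> ij; apply/val_inj; rewrite /= !sl_deltaK// 1?eq_sym// !mul_delta_mx.
by rewrite sl_of_mxK// raddfB /= !mxtrace_delta !eqxx subrr.
Qed.

End SpecialLinear.

Section LaurentPolynomials.
Variables (F : fieldType) (g : lmodType F).

(* g (x) F[t, t^-1], as the finitely supported functions int -> g:
   f corresponds to the sum of the f m (x) t^m. *)
Definition fin_supp : {pred (int -> g)} :=
  fun f => `[< finite_set [set m | f m != 0] >].

Fact fin_supp_submod : submod_closed fin_supp.
Proof.
split=> [|a f h].
  apply/asboolP; rewrite (_ : [set _ | _] = set0) ?finite_set0//.
  by apply/seteqP; split=> m //=; rewrite eqxx.
move=> /asboolP fF /asboolP hF; apply/asboolP.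
apply: (@sub_finite_set _ _ ([set m | f m != 0] `|` [set m | h m != 0])).
  move=> m /= fhm; case: (eqVneq (f m) 0) => [f0|]; last by left.
  right; apply: contra_neq fhm => h0.
  by rewrite -[LHS]/(a *: f m + h m) f0 h0 scaler0 addr0.
by rewrite finite_setU.
Qed.

HB.instance Definition _ :=
  GRing.isSubmodClosed.Build F (int -> g) fin_supp fin_supp_submod.

Record laurent : Type :=
  Laurent { laurent_fun :> int -> g; _ : laurent_fun \in fin_supp }.

HB.instance Definition _ := [isSub for laurent_fun].
HB.instance Definition _ := [Choice of laurent by <:].
HB.instance Definition _ := [SubChoice_isSubLmodule of laurent by <:].

Fact lmono_subproof (x : g) (m : int) :
  (fun k => if k == m then x else 0) \in fin_supp.
Proof.
apply/asboolP; apply: (@sub_finite_set _ _ [set m]); last exact: finite_set1.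
by move=> k /=; case: (eqVneq k m) => [->|_]; rewrite ?eqxx.
Qed.

(* x (x) t^m *)
Definition lmono (x : g) (m : int) : laurent := Laurent (lmono_subproof x m).

End LaurentPolynomials.

Section AffineLieAlgebra.
Variables (F : fieldType) (l : nat).
Local Notation sl := (sl F l).

(* sl_(l+1) (x) F[t, t^-1] (+) F c (+) F d; the triple (f, a, b) stands for
   f + a c + b d. *)
Definition affine : Type := (laurent sl * F^o * F^o)%type.

HB.instance Definition _ := GRing.Lmodule.on affine.

Definition loop_part (u : affine) : laurent sl := u.1.1.
Definition c_part (u : affine) : F := u.1.2.
Definition d_part (u : affine) : F := u.2.

(* x(m) = x (x) t^m *)
Definition aff (x : sl) (m : int) : affine := (lmono x m, 0, 0).
Definition aff_c : affine := (0, 1, 0).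
Definition aff_d : affine := (0, 0, 1).

Definition loop_bracket (f g : laurent sl) : laurent sl :=
  \sum_(m \in [set: int]) \sum_(n \in [set: int])
    lmono (sl_bracket (f m) (g n)) (m + n).

Definition cocycle (f g : laurent sl) : F :=
  \sum_(m \in [set: int]) m%:~R * sl_form (f m) (g (- m)).

(* t d/dt *)
Definition loop_deriv (f : laurent sl) : laurent sl :=
  \sum_(m \in [set: int]) lmono (m%:~R *: f m) m.

Definition aff_bracket (u w : affine) : affine :=
  (loop_bracket (loop_part u) (loop_part w)
     + d_part u *: loop_deriv (loop_part w)
     - d_part w *: loop_deriv (loop_part u),
   cocycle (loop_part u) (loop_part w), 0).

Fact fsum_supp1 (W : nmodType) (a : int) (G : int -> W) :
  (forall m, m != a -> G m = 0) -> \sum_(m \in [set: int]) G m = G a.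
Proof.
move=> G0; rewrite -(fsbig_widen [set a]) ?fsbig_set1// => m [_ /= ma].
by apply: G0; apply/eqP.
Qed.

Fact lmono0 (m : int) : lmono (0 : sl) m = 0.
Proof. by apply/val_inj/funext => k /=; case: ifP. Qed.

Fact sl_bracket0x (x : sl) : sl_bracket 0 x = 0.
Proof. by apply/val_inj; rewrite /= mul0mx mulmx0 subrr. Qed.

Fact sl_bracketx0 (x : sl) : sl_bracket x 0 = 0.
Proof. by apply/val_inj; rewrite /= mul0mx mulmx0 subrr. Qed.

Fact loop_bracket0f (f : laurent sl) : loop_bracket 0 f = 0.
Proof.
rewrite /loop_bracket fsbig1// => m _; rewrite fsbig1// => n _.
by rewrite sl_bracket0x lmono0.
Qed.

Fact loop_bracketf0 (f : laurent sl) : loop_bracket f 0 = 0.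
Proof.
rewrite /loop_bracket fsbig1// => m _; rewrite fsbig1// => n _.
by rewrite sl_bracketx0 lmono0.
Qed.

Fact loop_bracket_mono (x y : sl) (m n : int) :
  loop_bracket (lmono x m) (lmono y n) = lmono (sl_bracket x y) (m + n).
Proof.
rewrite /loop_bracket (@fsum_supp1 _ m) => [|k /negPf km].
  rewrite (@fsum_supp1 _ n) => [|k /negPf kn] /=; first by rewrite !eqxx.
  by rewrite kn sl_bracketx0 lmono0.
by rewrite fsbig1// => k' _ /=; rewrite km sl_bracket0x lmono0.
Qed.

Fact cocycle0f (f : laurent sl) : cocycle 0 f = 0.
Proof.
by rewrite /cocycle fsbig1// => m _; rewrite /sl_form mul0mx mxtrace0 mulr0.
Qed.

Fact cocycle_mono (x y : sl) (m n : int) :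
  cocycle (lmono x m) (lmono y n) =
  if m + n == 0 then m%:~R * sl_form x y else 0.
Proof.
rewrite /cocycle (@fsum_supp1 _ m) => [|k /negPf km] /=; last first.
  by rewrite km /sl_form mul0mx mxtrace0 mulr0.
rewrite eqxx eq_sym -addr_eq0 addrC; case: ifP => // _.
by rewrite /sl_form mulmx0 mxtrace0 mulr0.
Qed.

Fact loop_deriv_mono (x : sl) (m : int) :
  loop_deriv (lmono x m) = lmono (m%:~R *: x) m.
Proof.
rewrite /loop_deriv (@fsum_supp1 _ m) => [|k /negPf km] /=; first by rewrite eqxx.
by rewrite km scaler0 lmono0.
Qed.

Fact lmonoZ (a : F) (x : sl) (m : int) : lmono (a *: x) m = a *: lmono x m.
Proof.
apply/val_inj/funext => k /=.
by rewrite -[RHS]/(a *: (if k == m then x else 0)); case: ifP; rewrite ?scaler0.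
Qed.

Lemma aff_bracket_mono (x y : sl) (m n : int) :
  aff_bracket (aff x m) (aff y n) =
  aff (sl_bracket x y) (m + n)
    + (if m + n == 0 then m%:~R * sl_form x y else 0 : F) *: aff_c.
Proof.
rewrite /aff_bracket /= loop_bracket_mono cocycle_mono !scale0r subr0 addr0.
congr (_, _, _) => /=.
- by rewrite scaler0 addr0.
- by rewrite add0r [RHS]mulr1.
- by rewrite add0r [RHS]mulr0.
Qed.

Lemma aff_bracket_d (x : sl) (m : int) :
  aff_bracket aff_d (aff x m) = m%:~R *: aff x m.
Proof.
rewrite /aff_bracket /= loop_bracket0f cocycle0f loop_deriv_mono scale1r scale0r.
rewrite add0r subr0 lmonoZ; congr (_, _, _).
- by rewrite [RHS]mulr0.
- by rewrite [RHS]mulr0.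
Qed.

Lemma aff_bracket_c (u : affine) : aff_bracket aff_c u = 0.
Proof.
rewrite /aff_bracket /= loop_bracket0f cocycle0f scale0r addr0 add0r.
rewrite /loop_deriv fsbig1 => [|m _]; first by rewrite scaler0 oppr0.
by rewrite scaler0 lmono0.
Qed.

(* h (+) F c (+) F d *)
Definition aff_cartan : set affine :=
  [set u | cartan (loop_part u 0) /\
           forall m, m != 0 -> loop_part u m = 0].

(* n_+ (+) g (x) t F[t], with n_+ the strictly upper triangular matrices. *)
Definition aff_nplus : set affine :=
  [set u | [/\ c_part u = 0, d_part u = 0,
               forall m, m < 0 -> loop_part u m = 0 &
               forall i j : 'I_l.+1, (j <= i)%N ->
                 sl_mx (loop_part u 0) i j = 0]].

(* The index 0 of the affine Dynkin diagram is [ord0]; the indices 1, .., l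
   are the [hi i], i : 'I_l. *)
Definition chev_e (i : 'I_l.+1) : affine :=
  if unlift ord0 i is Some k then aff (sl_of_mx (delta_mx (lo k) (hi k))) 0
  else aff (sl_of_mx (delta_mx ord_max ord0)) 1.

Definition chev_f (i : 'I_l.+1) : affine :=
  if unlift ord0 i is Some k then aff (sl_of_mx (delta_mx (hi k) (lo k))) 0
  else aff (sl_of_mx (delta_mx ord0 ord_max)) (-1).

Definition aff_coroot (i : 'I_l.+1) : affine :=
  if unlift ord0 i is Some k then aff (simple_coroot F k) 0
  else aff_c - aff (theta_coroot F l) 0.

Lemma aff_bracket_ef (i : 'I_l.+1) : (0 < l)%N ->
  aff_bracket (chev_e i) (chev_f i) = aff_coroot i.
Proof.
move=> l0; rewrite /chev_e /chev_f /aff_coroot; case: unliftP => [k _|_].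
  have lohi : lo k != hi k by rewrite -val_eqE /= neq_ltn /= ltnSn.
  rewrite aff_bracket_mono sl_bracket_delta// addr0 eqxx mul0r scale0r addr0.
  by [].
have m0 : (ord_max : 'I_l.+1) != ord0 by rewrite -val_eqE /= -lt0n.
rewrite aff_bracket_mono sl_bracket_delta// subrr eqxx mul1r /sl_form.
rewrite !sl_deltaK// 1?eq_sym// mul_delta_mx mxtrace_delta.
rewrite eqxx scale1r.
rewrite addrC; congr (_ + _); congr (_, _, _); rewrite ?oppr0//.
apply/val_inj/funext => k /=.
rewrite -[RHS]/(- (if k == 0 then theta_coroot F l else 0)).
case: ifP => _; last by rewrite oppr0.
apply/val_inj; rewrite -[RHS]/(- sl_mx (theta_coroot F l)) theta_corootK opprB.
by rewrite /= sl_of_mxK// raddfB /= !mxtrace_delta !eqxx subrr.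
Qed.

(* The fundamental weight Lambda_r, restricted to the affine Cartan subalgebra;
   see [Lambda_coroot] and [Lambda_d]. *)
Definition Lambda (r : nat) (u : affine) : F :=
  c_part u + omega r (loop_part u 0).

Lemma Lambda_coroot (r i : 'I_l.+1) : Lambda r (aff_coroot i) = (i == r)%:R.
Proof.
rewrite /aff_coroot /Lambda; case: unliftP => [k ->|->] /=.
  rewrite add0r (omega_delta _ (simple_corootK _ _)) -val_eqE /= /bump leq0n add1n.
  by case: (ltngtP k.+1 r); rewrite ?subrr ?subr0.
rewrite (@omega_delta _ _ _ ord_max ord0).
  rewrite /c_part /= oppr0 addr0 -val_eqE /= [(l < r)%N]ltnNge -ltnS ltn_ord /=.
  by rewrite sub0r eq_sym; case: (posnP r) => _; rewrite ?subr0 ?subrr.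
rewrite -[LHS]/(0 - sl_mx (theta_coroot F l)) theta_corootK.
by rewrite sub0r opprB.
Qed.

Lemma Lambda_d (r : nat) : Lambda r aff_d = 0.
Proof. by rewrite /Lambda /omega add0r big1// => k _; rewrite mxE. Qed.

(* g_1 (x) F[t, t^-1] *)
Definition aff_g1 : set affine :=
  [set u | [/\ c_part u = 0, d_part u = 0 & forall m, g1 (loop_part u m)]].

End AffineLieAlgebra.

Arguments aff_c {F l}.
Arguments aff_d {F l}.

Section AffineModules.
Variables (F : fieldType) (l : nat) (V : lmodType F).
Variable rho : affine F l -> V -> V.

Definition is_affine_module : Prop :=
  [/\ forall a u w v, rho (a *: u + w) v = a *: rho u v + rho w v,
      forall u a v w, rho u (a *: v + w) = a *: rho u v + rho u w &
      forall u w v, rho (aff_bracket u w) v = rho u (rho w v) - rho w (rho u v)].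

Definition is_submodule (W : set V) : Prop :=
  [/\ W 0, forall a v w, W v -> W w -> W (a *: v + w) &
      forall u v, W v -> W (rho u v)].

Definition irreducible : Prop :=
  (exists v : V, v != 0) /\
  forall W, is_submodule W -> W = [set 0] \/ W = [set: V].

(* U(a) . v for a subalgebra a: the span of all a_1 (a_2 (... (a_k v))) with
   a_1, .., a_k in a and k >= 0. *)
Definition envelope_orbit (a : set (affine F l)) (v : V) : set V :=
  lin_span [set s : seq (affine F l) | forall u, u \in s -> a u]
           (fun s => foldr rho v s).

Definition highest_weight_vector (L : affine F l -> F) (v : V) : Prop :=
  [/\ v != 0, forall h, aff_cartan h -> rho h v = L h *: v &
      forall u, aff_nplus u -> rho u v = 0].

Definition locally_nilpotent (f : V -> V) : Prop :=
  forall v, exists k, iter k f v = 0.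

(* For highest weight modules the Cartan subalgebra acts diagonalizably, so
   that integrability is the condition on the Chevalley generators. *)
Definition integrable : Prop :=
  forall i, locally_nilpotent (rho (chev_e F i)) /\
            locally_nilpotent (rho (chev_f F i)).

(* These conditions determine (V, rho, v) up to isomorphism; the last one and
   integrability follow from the others when L is dominant integral. *)
Definition standard_module (L : affine F l -> F) (v : V) : Prop :=
  [/\ is_affine_module, irreducible, integrable,
      highest_weight_vector L v & envelope_orbit [set: affine F l] v = [set: V]].

Definition FS_subspace (v : V) : set V := envelope_orbit (@aff_g1 F l) v.

End AffineModules.

Section Monomials.
Variable l : nat.

(* The monomial with factors x_j(-m_(j,n)) is encoded by the sequences
   [b j] = [:: m_(j,1); ..; m_(j,n_j)], where [j : 'I_l] stands for j+1 in
   {1, .., l}, and where [nth 0 (b j) n] is m_(j,n+1). *)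
Definition monomial : Type := {ffun 'I_l -> seq nat}.

HB.instance Definition _ := Choice.on monomial.

Definition ordered_monomial (b : monomial) : Prop :=
  forall j, sorted leq (b j) /\ all (ltn 0) (b j).

Definition initial_conditions (r : nat) (b : monomial) : Prop :=
  forall (j : 'I_l) (n : nat), (n < size (b j))%N ->
    (1 + (\sum_(i < l | (i < j)%N) size (b i)) + (j.+1 <= r) <= nth 0 (b j) n)%N.

Definition difference_conditions (b : monomial) : Prop :=
  forall (j : 'I_l) (n : nat), (n.+1 < size (b j))%N ->
    (nth 0 (b j) n + 2 <= nth 0 (b j) n.+1)%N.

Definition admissible (r : nat) : set monomial :=
  [set b | [/\ ordered_monomial b, initial_conditions r b &
               difference_conditions b]].

(* b . v, where x_1(-m_(1,1)) acts first and x_l(-m_(l,n_l)) acts last. *)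
Definition monomial_vector (F : fieldType) (V : lmodType F)
    (rho : affine F l -> V -> V) (x : 'I_l -> sl F l) (v : V)
    (b : monomial) : V :=
  foldl (fun w j => foldl (fun w' (m : nat) => rho (aff (x j) (- m%:Z)) w') w (b j))
        v (enum 'I_l).

End Monomials.

(* Main.v *)
From HB Require Import structures.
Require Import Defs.
From mathcomp Require Import all_boot all_order all_algebra.
From mathcomp Require Import boolp classical_sets cardinality.
From mathcomp Require Import reals.
From mathcomp.real_closed Require Import complex.
From mathcomp Require Import zify ring.
Import Order.TTheory GRing.Theory Num.Theory.
Local Open Scope ring_scope.

Set Implicit Arguments.
Unset Strict Implicit.
Unset Printing Implicit Defensive.

(* Spectral flow by omega_r turns the highest weight vector v_r into a vacuum: a
   vector killed by all nonnegative modes, generating an irreducible module. On a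
   vacuum the coefficients of the products x_i(z) x_j(z) vanish, because they are
   singular vectors (by induction on the degree), and x_j(-1) v is again a vacuum
   for the currents transported by the spectral flow along gamma_j.

   Both halves of the theorem are inductions that peel off the lowest possible
   factor x_j(-1-delta_j) of the first colour j present in the monomials, where
   x_i(-p) v = 0 for p <= delta_i. Multiplying by that factor replaces v by
   v' = x_j(-1-delta_j) v and delta_i by delta_i + 1, or delta_j by delta_j + 2.
   - Spanning: modulo the image of this factor the same relations hold with
     delta_j + 1 instead of delta_j.
   - Independence: the elementary symmetric polynomial of top degree in the
     Cartan currents of colour j raises the mode of every factor of colour j by
     one. It annihilates exactly the monomials containing the lowest factor, so
     the coefficients of the other ones vanish by induction; what is left is a
     relation between monomials applied to v'. *)

(** * Subspaces, linear spans and separation of eigenvectors *)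

Section LinearSpan.
Variables (F : fieldType) (V : lmodType F).

Definition subspace (W : V -> Prop) : Prop :=
  W 0 /\ forall a u w, W u -> W w -> W (a *: u + w).

Lemma subspaceD W u w : subspace W -> W u -> W w -> W (u + w).
Proof. by move=> [_ Wl] Wu Ww; rewrite -[u]scale1r; apply: Wl. Qed.

Lemma subspaceZ W a u : subspace W -> W u -> W (a *: u).
Proof. by move=> [W0 Wl] Wu; rewrite -[_ *: u]addr0; apply: Wl. Qed.

Lemma subspaceN W u : subspace W -> W u -> W (- u).
Proof. by move=> Wsub Wu; rewrite -scaleN1r; exact: subspaceZ. Qed.

Lemma subspaceB W u w : subspace W -> W u -> W w -> W (u - w).
Proof. by move=> Wsub Wu Ww; apply: subspaceD => //; exact: subspaceN. Qed.

Lemma subspace_sum W (I : eqType) (s : seq I) (P : pred I) (f : I -> V) :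
  subspace W -> (forall i, i \in s -> P i -> W (f i)) ->
  W (\sum_(i <- s | P i) f i).
Proof.
move=> Wsub Wf; rewrite big_seq_cond; elim/big_ind: _ => [|u w|i /andP[]].
- by case: Wsub.
- exact: subspaceD.
- exact: Wf.
Qed.

(** [lin_span] has one coefficient per index, so the coefficients of repeated indices are added up
    over the duplicate-free list of indices. *)
Lemma lin_span_pairs (I : choiceType) (P : set I) (e : I -> V)
    (t : seq (F * I)) :
  (forall x, x \in t -> P x.2) -> lin_span P e (\sum_(x <- t) x.1 *: e x.2).
Proof.
move=> tP; exists (undup (map snd t)), (fun i => \sum_(x <- t | x.2 == i) x.1).
split=> [i|]; first by rewrite mem_undup => /mapP[x /tP + ->].
under [RHS]eq_bigr => i _ do rewrite scaler_suml.
rewrite (exchange_big_dep predT) //= big_seq [RHS]big_seq.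
apply: eq_bigr => x xt.
under eq_bigl => i do rewrite eq_sym.
rewrite -big_filter filter_pred1_uniq ?undup_uniq// ?big_seq1//.
by rewrite mem_undup; apply/mapP; exists x.
Qed.

Lemma lin_span_subspace (I : choiceType) (P : set I) (e : I -> V) :
  subspace (lin_span P e).
Proof.
split; first by exists [::], (fun=> 0); rewrite big_nil.
move=> a _ _ [s [c [sP ->]]] [s' [c' [s'P ->]]].
pose t := [seq (a * c i, i) | i <- s] ++ [seq (c' i, i) | i <- s'].
suff -> : a *: (\sum_(i <- s) c i *: e i) + \sum_(i <- s') c' i *: e i
          = \sum_(x <- t) x.1 *: e x.2.
  apply: lin_span_pairs => x; rewrite mem_cat.
  by move=> /orP[] /mapP[i +  ->]; [exact: sP|exact: s'P].
rewrite big_cat !big_map /= scaler_sumr; congr (_ + _).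
by apply: eq_bigr => i _; rewrite scalerA.
Qed.

Lemma lin_span_mem (I : choiceType) (P : set I) (e : I -> V) i u :
  P i -> u = e i -> lin_span P e u.
Proof.
move=> Pi ->; exists [:: i], (fun=> 1).
by split=> [j|]; rewrite ?big_seq1 ?scale1r// inE => /eqP->.
Qed.

Lemma lin_span_min (I : choiceType) (P : set I) (e : I -> V) W :
  subspace W -> (forall i, P i -> W (e i)) -> forall u, lin_span P e u -> W u.
Proof.
move=> Wsub We _ [s [c [sP ->]]]; apply: subspace_sum => // i /sP Pi _.
by apply: subspaceZ => //; exact: We.
Qed.

(** Applying [A - a j] to the relation removes the terms of an eigenvalue [a j] other than [a0] and
    multiplies those of eigenvalue [a0] by the nonzero scalar [a0 - a j]. The induction is on the
    number of terms whose eigenvalue is not [a0]. *)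
Lemma eigen_separation (A : {linear V -> V}) (I : eqType) (s : seq I)
    (a : I -> F) (y : I -> V) (a0 : F) :
  (forall i, i \in s -> A (y i) = a i *: y i) ->
  \sum_(i <- s) y i = 0 -> \sum_(i <- s | a i == a0) y i = 0.
Proof.
have [k] := ubnP (size [seq i <- s | a i != a0]).
elim: k s y => // k IH s y sk Ay y0.
case: (boolP (has (fun i => a i != a0) s)) => [/hasP[j js ja]|]; last first.
  rewrite -all_predC => /allP sa; rewrite -[RHS]y0 big_seq_cond [RHS]big_seq.
  by apply: eq_bigl => i; case: (boolP (i \in s)) => //= /sa /negPn ->.
pose s' := [seq i <- s | a i != a j].
have : \sum_(i <- s' | a i == a0) (a i - a j) *: y i = 0.
  apply: IH => [|i|].
  - move: sk; rewrite ltnS => sk; apply: (leq_trans _ sk); rewrite /s' -filter_predI.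
    rewrite (eq_filter (a2 := predI (fun i => a i != a j) (fun i => a i != a0))).
      rewrite filter_predI size_filter ltn_neqAle count_size -all_count andbT.
      by apply/allPn; exists j; rewrite ?eqxx// mem_filter ja.
    by move=> i /=; rewrite andbC.
  - by rewrite mem_filter => /andP[_ /Ay]; rewrite linearZ /= => ->; rewrite !scalerA mulrC.
  - have : A (\sum_(i <- s) y i) - a j *: \sum_(i <- s) y i = 0.
      by rewrite y0 linear0 scaler0 subrr.
    rewrite linear_sum /= scaler_sumr -sumrB big_filter => E.
    rewrite -[RHS]E [RHS](bigID (fun i => a i != a j)) /= addrC.
    rewrite [X in _ = X + _]big1_seq ?add0r; last first.
      move=> i /andP[/negPn/eqP ai /Ay ->]; by rewrite ai subrr.
    rewrite big_seq_cond [RHS]big_seq_cond; apply: eq_bigr => i /andP[/Ay -> _].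
    by rewrite scalerBl.
rewrite big_filter_cond => E.
have {}E : (a0 - a j) *: \sum_(i <- s | a i == a0) y i = 0.
  rewrite -[RHS]E scaler_sumr; apply: congr_big => // i.
    by case: eqP => [->|_]; rewrite ?andbF// eq_sym ja.
  by move=> /eqP ->.
by move/eqP: E; rewrite scaler_eq0 subr_eq0 eq_sym (negPf ja) /= => /eqP.
Qed.

End LinearSpan.

(** * Vacuum vectors of the current algebra and vanishing products of currents *)

Section CurrentAlgebra.
Variables (F : numFieldType) (l : nat) (V : lmodType F) (kappa : F).
Local Notation I := 'I_l.+1.

(* [e a b m] stands for E_ab(m). The term in [kappa] comes from the projection of
   gl onto sl, where [kappa] is 1 / (l + 1). *)
Definition current_comm (e : I -> I -> int -> {linear V -> V}) : Prop :=
  forall a b c d m n w,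
    e a b m (e c d n w) = e c d n (e a b m w)
      + (b == c)%:R *: e a d (m + n) w - (d == a)%:R *: e c b (m + n) w
      + (if m + n == 0 then
           m%:~R * ((b == c)%:R * (d == a)%:R - kappa * (a == b)%:R * (c == d)%:R)
         else 0) *: w.

(** The operator [d] measures the degree. Irreducibility is stated for subspaces that avoid [v], the
    form in which it excludes singular vectors. *)
Record vacuum (e : I -> I -> int -> {linear V -> V}) (d : {linear V -> V})
    (s : F) (v : V) : Prop := Vacuum {
  vac_comm : current_comm e;
  vac_d : forall a b m w, d (e a b m w) = e a b m (d w) + m%:~R *: e a b m w;
  vac_dv : d v = s *: v;
  vac_neq0 : v != 0;
  vac_kill : forall a b m, 0 <= m -> e a b m v = 0;
  vac_irr : forall W : V -> Prop, subspace W ->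
    (forall a b m w, W w -> W (e a b m w)) -> (forall w, W w -> W (d w)) ->
    ~ W v -> forall w, W w -> w = 0 }.

(** Positive modes are left out, so that the degree never rises above that of [w]; for a singular
    [w] this is nevertheless the whole submodule generated by it. *)
Inductive lowered (e : I -> I -> int -> {linear V -> V}) (w : V) : V -> Prop :=
| lowered_base : lowered e w w
| lowered_lin a u u' : lowered e w u -> lowered e w u' -> lowered e w (a *: u + u')
| lowered_act a b m u : m <= 0 -> lowered e w u -> lowered e w (e a b m u).

Lemma lowered_subspace e w : subspace (lowered e w).
Proof.
split=> [|a u u']; last exact: lowered_lin.
have -> : 0 = (-1) *: w + w by rewrite scaleN1r addNr.
by apply: lowered_lin; exact: lowered_base.
Qed.

(** A positive mode is commuted to the right until it reaches [w]; the commutators are again modes,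
    covered by the induction hypothesis for the shorter product. *)
Lemma lowered_stable e w :
  current_comm e -> (forall a b m, 0 < m -> e a b m w = 0) ->
  forall u a b m, lowered e w u -> lowered e w (e a b m u).
Proof.
move=> ecomm w0 u a b m Lu; elim: Lu a b m => {u} [|k u u' _ IH _ IH'|c d n u n0 Lu IH] a b m.
- have [m0|m0] := leP m 0; first by apply: lowered_act => //; exact: lowered_base.
  by rewrite w0//; case: (lowered_subspace e w).
- by rewrite linearP; exact: lowered_lin.
- have [m0|m0] := leP m 0; first by apply: lowered_act => //; exact: lowered_act.
  have S := lowered_subspace e w.
  rewrite ecomm; apply: subspaceD => //; last exact: subspaceZ.
  apply: subspaceB => //; last exact: subspaceZ.
  by apply: subspaceD => //; [exact: lowered_act|exact: subspaceZ].
Qed.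

(* [w] generates a submodule that misses [v], all its [d]-eigenvalues being
   smaller than [s]. *)
Lemma singular_eq0 e d s v w (k : nat) : vacuum e d s v ->
  (forall a b m, 0 < m -> e a b m w = 0) -> d w = (s - k.+1%:R) *: w -> w = 0.
Proof.
move=> vac w0 dw.
(* Every lowered vector is a sum of [d]-eigenvectors with eigenvalues among [s - 1, s - 2, ...]. *)
have Lgr u : lowered e w u -> exists t : seq (nat * V),
    (forall x, x \in t -> d x.2 = (s - x.1.+1%:R) *: x.2) /\ u = \sum_(x <- t) x.2.
  elim=> {u} [|a u u' _ [t [td ->]] _ [t' [t'd ->]]|a b m u m0 _ [t [td ->]]].
  - by exists [:: (k, w)]; split=> [x|]; rewrite ?inE ?big_seq1// => /eqP ->.
  - exists ([seq (x.1, a *: x.2) | x <- t] ++ t'); split=> [x|].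
      rewrite mem_cat => /orP[/mapP[y /td dy ->] /=|/t'd//].
      by rewrite linearZ /= dy !scalerA mulrC.
    by rewrite big_cat big_map /= scaler_sumr.
  - exists [seq ((x.1 + `|m|)%N, e a b m x.2) | x <- t]; split=> [x|].
      case/mapP=> y /td dy -> /=; rewrite (vac_d vac) dy linearZ /= -scalerDl.
      congr (_ *: _); rewrite -addSn natrD natr_absz ler0_norm// mulrNz.
      by rewrite opprD opprK addrA.
    by rewrite big_map linear_sum.
apply: (vac_irr vac (W := lowered e w)) => [|a b m u|u Lu|/Lgr[t [td vt]]|].
- exact: lowered_subspace.
- by apply: lowered_stable => //; exact: (vac_comm vac).
- elim: Lu => {u} [|a u u' _ IH _ IH'|a b m u m0 Lu IH].
  + by rewrite dw; apply: subspaceZ; [exact: lowered_subspace|exact: lowered_base].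
  + by rewrite linearP; exact: lowered_lin.
  + rewrite (vac_d vac); apply: subspaceD; first exact: lowered_subspace.
      exact: lowered_act.
    by apply: subspaceZ; [exact: lowered_subspace|exact: lowered_act].
(* If [v] were lowered, then [- v], listed as [None] with eigenvalue [s], would cancel against
   eigenvectors of other eigenvalues. *)
- have := @eigen_separation _ _ d (option (nat * V)) (None :: map Some t)
    (fun o => if o is Some x then s - x.1.+1%:R else s)
    (fun o => if o is Some x then x.2 else - v) s.
  rewrite !big_cons !big_map /= eqxx -vt addNr => sep.
  have : - v + \sum_(x <- t | s - x.1.+1%:R == s) x.2 = 0.
    apply: sep => // -[x|] /=; last by rewrite linearN /= (vac_dv vac) scalerN.
    by rewrite inE /= => /mapP[y /td dy [->]].
  rewrite big1 ?addr0 => [/eqP|x]; first by rewrite oppr_eq0 (negPf (vac_neq0 vac)).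
  by rewrite -subr_eq0 addrAC subrr add0r oppr_eq0 pnatr_eq0.
- exact: lowered_base.
Qed.

Definition current_mx (e : I -> I -> int -> {linear V -> V}) (y : 'M[F]_l.+1)
    (m : int) (w : V) : V := \sum_a \sum_b y a b *: e a b m w.

Section CurrentMatrix.
Variables (e : I -> I -> int -> {linear V -> V}) (ecomm : current_comm e).
Local Notation J := (current_mx e).

Fact current_mx_linear y m : linear (J y m).
Proof.
move=> a u w; rewrite /current_mx scaler_sumr -big_split; apply: eq_bigr => i _ /=.
rewrite scaler_sumr -big_split; apply: eq_bigr => j _ /=.
by rewrite linearP scalerDr !scalerA mulrC.
Qed.

HB.instance Definition _ y m :=
  GRing.isLinear.Build F V V _ (J y m) (current_mx_linear y m).

Lemma current_mxP a y z m w : J (a *: y + z) m w = a *: J y m w + J z m w.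
Proof.
rewrite /current_mx scaler_sumr -big_split; apply: eq_bigr => i _ /=.
rewrite scaler_sumr -big_split; apply: eq_bigr => j _ /=.
by rewrite !mxE scalerDl scalerA.
Qed.

Lemma current_mxD y z m w : J (y + z) m w = J y m w + J z m w.
Proof. by rewrite -[y]scale1r current_mxP !scale1r. Qed.

Lemma current_mxN y m w : J (- y) m w = - J y m w.
Proof.
rewrite /current_mx -sumrN; apply: eq_bigr => a _.
by rewrite -sumrN; apply: eq_bigr => b _; rewrite mxE scaleNr.
Qed.

Lemma current_mxZ a y m w : J (a *: y) m w = a *: J y m w.
Proof.
rewrite /current_mx scaler_sumr; apply: eq_bigr => i _.
by rewrite scaler_sumr; apply: eq_bigr => j _; rewrite mxE scalerA.
Qed.

Lemma current_mx_delta a b m w : J (delta_mx a b) m w = e a b m w.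
Proof.
rewrite /current_mx (bigD1 a)//= [X in _ + X]big1 => [|i ia].
  rewrite addr0 (bigD1 b)//= big1 => [|j jb]; first by rewrite addr0 mxE !eqxx scale1r.
  by rewrite mxE eqxx (negPf jb) scale0r.
by rewrite big1// => j _; rewrite mxE (negPf ia) scale0r.
Qed.

Lemma mx_linear_ind (P : 'M[F]_l.+1 -> Prop) :
  P 0 -> (forall a y z, P y -> P z -> P (a *: y + z)) ->
  (forall a b, P (delta_mx a b)) -> forall y, P y.
Proof.
move=> P0 Plin Pd y; rewrite [y]matrix_sum_delta.
have PD u w : P u -> P w -> P (u + w) by rewrite -{2}[u]scale1r; exact: Plin.
elim/big_ind: _ => // a _; elim/big_ind: _ => // b _.
by rewrite -[_ *: _]addr0; apply: Plin.
Qed.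

(** Both sides are bilinear in [y] and [z], which reduces the identity to matrix units, that is, to
    [current_comm]. *)
Lemma current_mx_comm y z m n w :
  J y m (J z n w) = J z n (J y m w) + J (y *m z - z *m y) (m + n) w
   + (if m + n == 0 then m%:~R * (\tr (y *m z) - kappa * \tr y * \tr z) else 0) *: w.
Proof.
have ac (u1 u2 u3 u1' u2' u3' : V) :
  (u1 + u2 + u3) + (u1' + u2' + u3') = (u1 + u1') + (u2 + u2') + (u3 + u3').
  by rewrite addrACA; congr (_ + _); rewrite addrACA.
have J0 k u : J 0 k u = 0 by rewrite -[0](scale0r (0 : 'M_l.+1)) current_mxZ scale0r.
elim/mx_linear_ind: y z => [z|a y y' IH IH' z|a b z].
- rewrite !J0 linear0 !mul0mx mulmx0 subr0 J0 mxtrace0 mulr0 mul0r subr0 mulr0.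
  by rewrite if_same scale0r !addr0.
- rewrite !current_mxP IH IH' !scalerDr ac linearP -current_mxP; congr (_ + _ + _).
    rewrite mulmxDl mulmxDr -scalemxAl -scalemxAr scalerBr.
    by congr (J _ _ _); rewrite opprD addrACA.
  rewrite scalerA -scalerDl; congr (_ *: _); case: ifP; rewrite ?mulr0 ?addr0//.
  by rewrite mulmxDl -scalemxAl !mxtraceD !mxtraceZ => _; ring.
elim/mx_linear_ind: z => [|c z z' IH IH'|c d].
- rewrite !J0 linear0 !mul0mx mulmx0 subr0 J0 mxtrace0 mulr0 subr0 mulr0.
  by rewrite if_same scale0r !addr0.
- rewrite !current_mxP [LHS]current_mx_linear IH IH' !scalerDr ac; congr (_ + _ + _).
    rewrite -current_mxP mulmxDl mulmxDr -scalemxAl -scalemxAr scalerBr.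
    by congr (J _ _ _); rewrite opprD addrACA.
  rewrite scalerA -scalerDl; congr (_ *: _); case: ifP; rewrite ?mulr0 ?addr0//.
  by rewrite mulmxDr -scalemxAr !mxtraceD !mxtraceZ => _; ring.
rewrite !current_mx_delta ecomm -!addrA; congr (_ + _).
rewrite !mul_delta_mx_cond current_mxD current_mxN -!scaler_nat !current_mxZ.
rewrite !current_mx_delta -!addrA; do 2!congr (_ + _); congr (_ *: _).
by case: ifP => // _; rewrite mxtraceZ !mxtrace_delta [a == d]eq_sym.
Qed.

Variables (d : {linear V -> V}) (s : F) (v : V) (vac : vacuum e d s v).

Lemma current_mx_kill y m : 0 <= m -> J y m v = 0.
Proof.
by move=> m0; rewrite /current_mx big1// => a _; rewrite big1// => b _;
  rewrite (vac_kill vac)// scaler0.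
Qed.

Lemma current_mx_d y m w : d (J y m w) = J y m (d w) + m%:~R *: J y m w.
Proof.
rewrite /current_mx linear_sum scaler_sumr -big_split; apply: eq_bigr => a _ /=.
rewrite linear_sum scaler_sumr -big_split; apply: eq_bigr => b _ /=.
by rewrite linearZ /= (vac_d vac) scalerDr !scalerA [_ * y a b]mulrC.
Qed.

(* The sum is the coefficient of the product of the currents of [x] and [y],
   applied to [v]. It is a singular vector by induction on [n], because
   [J z m] maps the [n]-th coefficient to [J z 0] of the [(n-m)]-th one. *)
Lemma current_product_eq0 (x y : 'M[F]_l.+1) :
  x *m y = 0 -> y *m x = 0 -> \tr x = 0 -> \tr y = 0 ->
  (forall z, x *m z *m y + y *m z *m x = \tr (z *m x) *: y + \tr (z *m y) *: x) ->
  forall n : nat,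
  \sum_(1 <= a < n) J x (- a%:Z) (J y (- (n - a)%N%:Z) v) = 0.
Proof.
move=> xy yx trx try xzy n; have [k] := ubnP n; elim: k n => // k IH n nk.
have {}IH m : (0 < m < n)%N ->
  \sum_(1 <= a < n - m) J x (- a%:Z) (J y (- (n - m - a)%N%:Z) v) = 0.
  by move=> mn; apply: IH; lia.
have [n2|n2] := leqP n 1; first by rewrite big_geq.
set u := (X in X = 0).
have zu z (m : nat) : (0 < m)%N -> J z m%:Z u = 0.
  move=> m0; rewrite /u linear_sum /=.
  (* This is the double commutator [[[z, x], y]]. *)
  have dbl : (z *m x - x *m z) *m y - y *m (z *m x - x *m z)
             = - (\tr (z *m x) *: y + \tr (z *m y) *: x).
    rewrite -xzy mulmxBl mulmxBr -!mulmxA xy mulmx0 sub0r.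
    by rewrite !mulmxA yx mul0mx subr0 opprD.
  have trzxy : \tr ((z *m x - x *m z) *m y) = 0.
    rewrite mulmxBl raddfB /= -mulmxA xy mulmx0 mxtrace0 sub0r.
    by rewrite -mulmxA mxtrace_mulC -mulmxA yx mulmx0 mxtrace0 oppr0.
  (* Moving [J z m] to the right produces the commutators with [y] ([A1]) and with [x] ([A3]), and
     the central terms [A2] and [A4], each of which occurs for one value of [a] only. *)
  pose A1 a := J x (- a%:Z) (J (z *m y - y *m z) (m%:Z - (n - a)%N%:Z) v).
  pose A2 a := if a == (n - m)%N then (m%:R * \tr (z *m y)) *: J x (- a%:Z) v else 0.
  pose A3 a := J (z *m x - x *m z) (m%:Z - a%:Z) (J y (- (n - a)%N%:Z) v).
  pose A4 a := if a == m then (m%:R * \tr (z *m x)) *: J y (- (n - a)%N%:Z) v else 0.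
  have -> : \sum_(1 <= a < n) J z m (J x (- a%:Z) (J y (- (n - a)%N%:Z) v))
     = \sum_(1 <= a < n) (A1 a + A2 a + (A3 a + A4 a)).
    apply: eq_big_nat => a an; rewrite current_mx_comm [J z m (J y _ v)]current_mx_comm.
    rewrite (current_mx_kill z (m := m%:Z))// linear0 add0r linearD -!addrA; congr (_ + _).
    rewrite trx try !mulr0 !subr0 /A2 /A3 /A4; congr (_ + (_ + _)).
      rewrite [X in if X then _ else _](_ : _ = (a == n - m)%N); last by lia.
      case: eqP => _; last by rewrite scale0r linear0.
      by rewrite linearZ.
    rewrite [X in if X then _ else _](_ : _ = (a == m)%N); last by lia.
    by case: eqP => _; rewrite ?scale0r.
  (* For [a <= m] the mode of the commutator is nonnegative, so it moves on to [v] and leaves the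
     double commutator, independent of [a]. *)
  have A3le a : (a <= m)%N -> (a < n)%N ->
      A3 a = - J (\tr (z *m x) *: y + \tr (z *m y) *: x) (m%:Z - n%:Z) v.
    move=> am an; rewrite /A3 current_mx_comm current_mx_kill; last by lia.
    rewrite linear0 add0r dbl current_mxN trzxy try !(mulr0, subr0) if_same scale0r addr0.
    by congr (- J _ _ _); lia.
  (* For [n <= m] every mode that reaches [v] is nonnegative, and the central terms do not occur. *)
  have [nm|mn] := leqP n m.
    rewrite big_nat big1// => a an; rewrite A3le ?current_mx_kill; try lia.
    rewrite oppr0 add0r /A1 current_mx_kill ?linear0 ?add0r; last by lia.
    by rewrite /A2 /A4 !ifF ?addr0//; apply/negbTE; lia.
  rewrite !big_split /=.
  have -> : \sum_(1 <= a < n) A2 a = (m%:R * \tr (z *m y)) *: J x (m%:Z - n%:Z) v.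
    rewrite (big_cat_nat (n := (n - m)%N)) /=; try lia.
    rewrite big_nat big1 ?add0r => [|a an]; last by rewrite /A2 ifF//; apply/negbTE; lia.
    rewrite big_ltn; last by lia.
    rewrite [X in _ + X]big_nat big1 ?addr0 => [|a an]; last by rewrite /A2 ifF//; apply/negbTE; lia.
    by rewrite /A2 eqxx; congr (_ *: J _ _ _); lia.
  have -> : \sum_(1 <= a < n) A4 a = (m%:R * \tr (z *m x)) *: J y (m%:Z - n%:Z) v.
    rewrite (big_cat_nat (n := m)) /=; try lia.
    rewrite big_nat big1 ?add0r => [|a an]; last by rewrite /A4 ifF//; apply/negbTE; lia.
    rewrite big_ltn; last by lia.
    rewrite [X in _ + X]big_nat big1 ?addr0 => [|a an]; last by rewrite /A4 ifF//; apply/negbTE; lia.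
    by rewrite /A4 eqxx; congr (_ *: J _ _ _); lia.
  have -> : \sum_(1 <= a < n) A1 a = \sum_(1 <= a < n - m)
       J x (- a%:Z) (J (z *m y - y *m z) (- (n - m - a)%N%:Z) v).
    rewrite (big_cat_nat (n := (n - m)%N)) /=; try lia.
    rewrite [X in _ + X]big_nat [X in _ + X]big1 ?addr0 => [|a an]; last first.
      by rewrite /A1 current_mx_kill ?linear0//; lia.
    by apply: eq_big_nat => a an; rewrite /A1; congr (J _ _ (J _ _ _)); lia.
  have -> : \sum_(1 <= a < n) A3 a =
      - (m%:R *: J (\tr (z *m x) *: y + \tr (z *m y) *: x) (m%:Z - n%:Z) v) +
      \sum_(1 <= a < n - m) J (z *m x - x *m z) (- a%:Z) (J y (- (n - m - a)%N%:Z) v).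
    rewrite (big_cat_nat (n := m.+1)) /=; try lia.
    congr (_ + _).
      rewrite big_nat (eq_bigr (fun=> - J (\tr (z *m x) *: y + \tr (z *m y) *: x)
        (m%:Z - n%:Z) v)) => [|a an]; last by rewrite A3le//; lia.
      by rewrite -big_nat sumr_const_nat subn1 -scalerN scaler_nat.
    rewrite -{1}[m.+1]add1n big_addn; apply: eq_big_nat => a an; rewrite /A3.
    by congr (J _ _ (J _ _ _)); lia.
  (* The induction hypothesis at [n - m]: applying [J z 0] to that coefficient gives exactly what
     remains of [A1] and [A3]. The first [m] terms of [A3] cancel the central terms. *)
  have : J z 0 (\sum_(1 <= a < n - m) J x (- a%:Z) (J y (- (n - m - a)%N%:Z) v)) = 0.
    by rewrite IH ?linear0//; lia.
  rewrite linear_sum /= => E.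
  have {}E : \sum_(1 <= a < n - m) J x (- a%:Z) (J (z *m y - y *m z) (- (n - m - a)%N%:Z) v)
     + \sum_(1 <= a < n - m) J (z *m x - x *m z) (- a%:Z) (J y (- (n - m - a)%N%:Z) v) = 0.
    rewrite -[RHS]E -big_split; apply: eq_big_nat => a an /=.
    rewrite [RHS]current_mx_comm [J z 0 (J y _ v)]current_mx_comm (current_mx_kill z (m := 0))//.
    by rewrite linear0 !mul0r !if_same !scale0r !add0r !addr0.
  rewrite current_mxP current_mxZ scalerDr !scalerA opprD !addrA.
  by rewrite (ACl ((1 * 5) * ((2 * 4) * (3 * 6))))%AC /= E subrr addNr !addr0.
(* The [d]-eigenvalue of [u] is [s - n], hence the choice [k = n.-1]. *)
apply: (singular_eq0 (k := n.-1) vac) => [a b m m0|].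
  by rewrite -current_mx_delta -(gez0_abs (ltW m0)) zu// absz_gt0 gt_eqF.
rewrite /u linear_sum scaler_sumr; apply: eq_big_nat => a an /=.
rewrite !current_mx_d (vac_dv vac) [J y _ (s *: v)]linearZ -scalerDl /=.
rewrite [J x _ (_ *: _)]linearZ -scalerDl; congr (_ *: _) => /=.
rewrite prednK; last by lia.
rewrite !mulrNz -addrA -opprD -[_%:~R + _](natrD _ (n - a) a); congr (_ - _%:R); lia.
Qed.

End CurrentMatrix.
End CurrentAlgebra.

(** * Spectral flow and the passage from one vacuum to the next *)

Section SpectralFlow.
Variables (F : numFieldType) (l : nat) (V : lmodType F) (kappa : F).
Local Notation I := 'I_l.+1.
Implicit Types (e : I -> I -> int -> {linear V -> V}) (d : {linear V -> V}).

(** The constant [c0] is free, since only differences of the diagonal zero modes occur in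
    commutators; it is chosen to make these modes kill the vacuum. *)
Definition flow (lam : I -> int) (c0 : F) e a b m : {linear V -> V} :=
  e a b (m - lam a + lam b)
    \+ ((if (a == b) && (m == 0) then c0 - (lam a)%:~R else 0) \*: idfun).

Lemma flowE lam c0 e a b m w : flow lam c0 e a b m w = e a b (m - lam a + lam b) w
  + (if (a == b) && (m == 0) then c0 - (lam a)%:~R else 0) *: w.
Proof. by []. Qed.

(** The added zero mode along [lam] compensates the shift of the modes, so that the flowed mode [m]
    has degree [m] again. *)
Definition flow_d (lam : I -> int) e d w : V :=
  d w + \sum_a (lam a)%:~R *: e a a 0 w.

Fact flow_d_linear lam e d : linear (flow_d lam e d).
Proof.
move=> a u w; rewrite /flow_d linearP scalerDr addrACA; congr (_ + _).
rewrite scaler_sumr -big_split; apply: eq_bigr => c _ /=.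
by rewrite linearP scalerDr !scalerA mulrC.
Qed.

HB.instance Definition _ lam e d :=
  GRing.isLinear.Build F V V _ (flow_d lam e d) (flow_d_linear lam e d).

(** Shifting the modes changes the central term of [[E_ab(m), E_ba(-m)]] by [lam b - lam a], which
    is the difference of the constants added to [E_aa(0)] and [E_bb(0)]. *)
Lemma flow_comm lam c0 e : current_comm kappa e -> current_comm kappa (flow lam c0 e).
Proof.
move=> ecomm a b c d m n w; rewrite !flowE !linearD !linearZ /= ecomm.
set M := m - _ + _; set N := n - _ + _.
set ka := (if (a == b) && _ then _ else _); set kc := (if (c == d) && _ then _ else _).
have ac (A B C D K1 K2 K3 : V) :
  A + B - C + D + K1 + (K2 + K3) = (A + K2 + (K1 + K3)) + (B - C + D).
  by rewrite !addrA (ACl (1 * 6 * 5 * 7 * 2 * 3 * 4))%AC.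
rewrite ac [ka *: (kc *: w)]scalerA [ka * kc]mulrC -scalerA -!addrA; do 4!congr (_ + _).
rewrite {}/M {}/N {ka kc ac}.
have [bc|bc] := eqVneq b c; have [da|da] := eqVneq d a; rewrite ?scale1r ?scale0r ?add0r.
- subst c d; rewrite /= [b == a]eq_sym.
  have -> : m + (- lam a + (lam b + (n - lam b + lam a))) = m + n by ring.
  have E k : m + (n + (- lam k + lam k)) = m + n by ring.
  rewrite !E.
  case: eqP => mn; last by rewrite !(scale0r, add0r, addr0).
  congr (_ + _). rewrite [RHS]addrCA. congr (_ + _).
  rewrite scalerN -scaleNr -!scalerDl; congr (_ *: _).
  have [->|_] := eqVneq a b; first by rewrite /=; ring.
  by rewrite /= !rmorphD !rmorphN /=; ring.
- rewrite oppr0 !add0r /= mulr0 sub0r; congr (_ + _).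
    by congr (e _ _ _ _); rewrite bc; ring.
  congr (_ *: _).
  have [ab|] := eqVneq a b; last by rewrite /= !(mulr0, mul0r, oppr0) !if_same.
  have [cd|] := eqVneq c d; last by rewrite /= !(mulr0, mul0r, oppr0) !if_same.
  by case/eqP: da; rewrite ab bc cd.
- rewrite scaler0 add0r /= mul0r sub0r; congr (_ + _).
    by congr (- e _ _ _ _); rewrite da; ring.
  congr (_ *: _).
  have [ab|] := eqVneq a b; last by rewrite /= !(mulr0, mul0r, oppr0) !if_same.
  have [cd|] := eqVneq c d; last by rewrite /= !(mulr0, mul0r, oppr0) !if_same.
  by case/eqP: bc; rewrite -ab cd.
- rewrite /= !(oppr0, scaler0, add0r, mul0r, sub0r); congr (_ *: _).
  have [ab|] := eqVneq a b; last by rewrite /= !(mulr0, mul0r, oppr0) !if_same.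
  have [cd|] := eqVneq c d; last by rewrite /= !(mulr0, mul0r, oppr0) !if_same.
  subst b d. have -> : m + (- lam a + (lam a + (n - lam c + lam c))) = m + n by ring.
  by rewrite subrK.
Qed.

Lemma flow_dP kappa' lam c0 e d : current_comm kappa' e ->
  (forall a b m w, d (e a b m w) = e a b m (d w) + m%:~R *: e a b m w) ->
  forall a b m w, flow_d lam e d (flow lam c0 e a b m w)
    = flow lam c0 e a b m (flow_d lam e d w) + m%:~R *: flow lam c0 e a b m w.
Proof.
move=> ecomm de a b m w.
have E M : flow_d lam e d (e a b M w)
  = e a b M (flow_d lam e d w) + (M + lam a - lam b)%:~R *: e a b M w.
  rewrite /flow_d de [X in _ = X + _]linearD -!addrA; congr (_ + _).
  rewrite intrD scalerDl addrCA; congr (_ + _).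
  rewrite linear_sum rmorphB /= scalerBl.
  have pick (k : I) (f : I -> V) : \sum_c (lam c)%:~R *: ((c == k)%:R *: f c) = (lam k)%:~R *: f k.
    rewrite (bigD1 k)//= eqxx scale1r big1 ?addr0// => c /negPf ->.
    by rewrite scale0r scaler0.
  transitivity (\sum_c (e a b M ((lam c)%:~R *: e c c 0 w)
      + ((lam c)%:~R *: ((c == a)%:R *: e c b M w)
         - (lam c)%:~R *: ((c == b)%:R *: e a c M w)))).
    apply: eq_bigr => c _; rewrite ecomm mul0r if_same scale0r addr0 add0r.
    by rewrite [in RHS]linearZ /= -addrA !scalerDr !scalerN [b == c]eq_sym.
  by rewrite big_split sumrB /= !pick.
rewrite !flowE addrC flow_d_linear E.
set k := (if _ then _ else 0); have mk : m%:~R * k = 0.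
  by rewrite /k; case: ifP => [/andP[_ /eqP->]|]; rewrite ?mul0r ?mulr0.
rewrite [m%:~R *: (_ + _)]scalerDr [m%:~R *: (k *: w)]scalerA mk scale0r add0r.
rewrite addrA [k *: _ + _]addrC; congr (_ + _ *: _); congr _%:~R; ring.
Qed.

(** The old currents and [d] are combinations of the flowed ones and the identity, so a subspace
    stable under the latter is stable under the former. *)
Lemma flow_irr lam c0 e d v :
  (forall W : V -> Prop, subspace W ->
    (forall a b m w, W w -> W (e a b m w)) -> (forall w, W w -> W (d w)) ->
    ~ W v -> forall w, W w -> w = 0) ->
  forall W : V -> Prop, subspace W ->
    (forall a b m w, W w -> W (flow lam c0 e a b m w)) ->
    (forall w, W w -> W (flow_d lam e d w)) ->
    ~ W v -> forall w, W w -> w = 0.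
Proof.
move=> irr W Wsub We Wd Wv.
have {}We a b m w : W w -> W (e a b m w).
  move=> Ww; have := We a b (m + lam a - lam b) w Ww; rewrite flowE.
  rewrite (_ : m + lam a - lam b - lam a + lam b = m); last by ring.
  set k := (if _ then _ else _) => H.
  by rewrite -[e a b m w](addrK (k *: w)); apply: subspaceB => //; exact: subspaceZ.
apply: irr => // w Ww; rewrite -[d w](addrK (\sum_a (lam a)%:~R *: e a a 0 w)).
apply: subspaceB => //; first exact: Wd.
by apply: subspace_sum => // a _ _; apply: subspaceZ => //; exact: We.
Qed.

Lemma mul_delta_mx_delta (z : 'M[F]_l.+1) (a b c f : I) :
  delta_mx a b *m z *m delta_mx c f = z b c *: delta_mx a f.
Proof.
apply/matrixP => i j; rewrite !mxE (bigD1 c)//= big1 => [|k kc]; last first.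
  by rewrite [delta_mx c f k j]mxE (negPf kc) mulr0.
rewrite addr0 mxE (bigD1 b)//= big1 => [|k kb]; last by rewrite mxE (negPf kb) andbF mul0r.
by rewrite addr0 !mxE !eqxx andbT /= -mulnb natrM; ring.
Qed.

Lemma mxtrace_mul_delta (z : 'M[F]_l.+1) (a b : I) : \tr (z *m delta_mx a b) = z b a.
Proof.
rewrite /mxtrace (bigD1 b)//= big1 => [|i ib]; rewrite mxE (bigD1 a)//= big1 => [|k ka].
- by rewrite !addr0 mxE !eqxx mulr1.
- by rewrite mxE (negPf ka) mulr0.
- by rewrite addr0 mxE (negPf ib) andbF mulr0.
- by rewrite mxE (negPf ka) mulr0.
Qed.

(** Two matrix units in a common row or column satisfy the identity required of [x] and [y] in
    [current_product_eq0]. *)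
Lemma root_product_eq0 e d s v a b a' b' n : vacuum kappa e d s v ->
  a != b -> a' != b' -> b != a' -> b' != a -> (a == a') || (b == b') ->
  \sum_(1 <= k < n) e a b (- k%:Z) (e a' b' (- (n - k)%N%:Z) v) = 0.
Proof.
move=> vac ab ab' ba' b'a aabb.
rewrite -[RHS](current_product_eq0 (vac_comm vac) vac (x := delta_mx a b) (y := delta_mx a' b') _ _ _ _ _ n).
- by apply: eq_bigr => k _; rewrite !current_mx_delta.
- exact: mul_delta_mx_0.
- exact: mul_delta_mx_0.
- by rewrite mxtrace_delta (negPf ab).
- by rewrite mxtrace_delta (negPf ab').
move=> z; rewrite !mul_delta_mx_delta !mxtrace_mul_delta.
by case/orP: aabb => /eqP <- //; rewrite addrC.
Qed.

(* The coroot of [gamma_i]. *)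
Definition root_cochar (i : I) (a : I) : int := (a == i)%:Z - (a == ord_max)%:Z.

(** The modes that have to kill [w] either commute past [E_(i,max)(-1)] with a commutator that kills
    [v], or are critical: [E_ab(-1)] with [a = i] or [b = ord_max], and [E_(i,max)(-2)]. The
    critical ones are handled by the vanishing products of currents. *)
Lemma vacuum_next e d s v i : vacuum kappa e d s v -> i != ord_max ->
  vacuum kappa (flow (root_cochar i) 0 e) (flow_d (root_cochar i) e d) (s + 1)
    (e i ord_max (-1) v).
Proof.
move=> vac iM; have ecomm := vac_comm vac; set w := e i ord_max (-1) v.
(* The opposite root vector leads back to [v], so [w] is nonzero. *)
have back : e ord_max i 1 w = v.
  rewrite /w ecomm !(vac_kill vac)// linear0 !scaler0 !addr0 subr0 add0r subrr eqxx.
  by rewrite !eqxx (negPf iM) mulr0 subr0 !mulr1 scale1r.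
have eaa a : e a a 0 w = ((a == i)%:R - (a == ord_max)%:R) *: w.
  rewrite /w ecomm (vac_kill vac)// linear0 /= scale0r !add0r addr0.
  rewrite scalerBl; congr (_ - _).
    by have [->|] := eqVneq a i; rewrite ?scale0r.
  by rewrite eq_sym; have [->|] := eqVneq a ord_max; rewrite ?scale0r.
split.
- exact: flow_comm.
- by apply: flow_dP => //; exact: vac_d vac.
- have dw : d w = (s - 1) *: w.
    by rewrite /w (vac_d vac) (vac_dv vac) linearZ -scalerDl.
  rewrite [LHS]/= /flow_d dw.
  (* The weights [1] and [-1] of [w] at [i] and [ord_max] agree with the cocharacter, so each of the
     two indices contributes [1] to the eigenvalue. *)
  rewrite (eq_bigr (fun a => ((a == i)%:R + (a == ord_max)%:R) *: w)) => [|a _].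
    rewrite -scaler_suml -!scalerDl; congr (_ *: _).
    have pick k : \sum_(a < l.+1) (a == k)%:R = 1 :> F.
      by rewrite (bigD1 k)//= eqxx big1 ?addr0// => a /negPf->.
    by rewrite big_split /= !pick; ring.
  rewrite eaa scalerA; congr (_ *: _); rewrite /root_cochar rmorphB /=.
  have [->|_] := eqVneq a i; first by rewrite (negPf iM) /=; ring.
  by case: eqP => _ /=; ring.
- by apply: contra_neq (vac_neq0 vac) => w0; rewrite -back w0 linear0.
- have Mi : (ord_max == i) = false by rewrite eq_sym (negPf iM).
  have kill a b k : a != b -> 0 <= k -> (0 < k) || (b != i) && (a != ord_max) ->
    (1 < k) || (b != i) || (a != ord_max) -> e a b k w = 0.
    move=> ab k0 k1 k2; rewrite /w ecomm (vac_kill vac)// linear0 add0r (negPf ab).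
    rewrite mulr0 mul0r subr0 -natrM mulnb [ord_max == a]eq_sym.
    have [k1'|] := boolP (0 < k).
      rewrite !(vac_kill vac) ?scaler0 ?subr0 ?add0r; try lia.
      case: eqP => // kE; last by rewrite scale0r.
      have k1n : (1 < k) = false by lia.
      by move: k2; rewrite k1n /= -negb_and => /negPf ->; rewrite mulr0 scale0r.
    move=> k1'; move: k1; rewrite (negPf k1') /= => /andP[/negPf-> /negPf->].
    by rewrite !scale0r subr0 mulr0 if_same scale0r addr0.
  (* For [n = 2] the coefficient is the single term [E_ab(-1) E_(i,max)(-1) v]. *)
  have prod a b (ab : a != b) (bi : b != i) (aM : a != ord_max) :
      (a == i) || (b == ord_max) -> e a b (-1) w = 0.
    move=> aib; have := root_product_eq0 2 vac ab iM bi _ aib.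
    by rewrite big_nat1 eq_sym; exact.
  (* For [n = 3] it consists of two equal terms, because these modes commute. *)
  have prod3 : e i ord_max (-2) w = 0.
    have := root_product_eq0 3 vac iM iM _ _ _.
    rewrite big_ltn// big_nat1 eq_sym eqxx iM => /(_ isT isT isT).
    rewrite [X in X + _]ecomm Mi /= !scale0r subr0 !addr0.
    by rewrite -mulr2n -scaler_nat => /eqP; rewrite scaler_eq0 pnatr_eq0 => /eqP.
  move=> a b m m0; rewrite flowE /root_cochar; have [<-|ab] := eqVneq a b.
    rewrite subrK /=; have [->|m1] := eqVneq m 0.
      by rewrite eaa -scalerDl rmorphB sub0r subrr scale0r.
    rewrite scale0r addr0 /w ecomm !(vac_kill vac) ?linear0 ?scaler0 ?addr0; try lia.
    rewrite ?(oppr0, subr0, add0r, addr0); case: ifP => _; last by rewrite scale0r.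
    rewrite (negPf iM) mulr0 subr0 -natrM mulnb.
    by have [->|] := eqVneq a i; rewrite ?Mi mulr0 scale0r.
  rewrite scale0r addr0.
  have [ai|ai] := eqVneq a i; [|have [aM|aM] := eqVneq a ord_max].
  - have bi : b != i by rewrite -ai eq_sym.
    have [bM|bM] := eqVneq b ord_max; rewrite ai ?bM ?Mi ?(negPf bi) (negPf iM) /=.
      case: m m0 => // -[|[|m]] _; [exact: prod3| |by apply: kill => //; lia].
      by apply: prod; rewrite ?Mi ?eqxx.
    have ib : i != b by rewrite eq_sym.
    case: m m0 => // -[|m] _; last by apply: kill; rewrite ?bi ?iM ?orbT//; lia.
    by apply: prod => //; rewrite eqxx.
  - rewrite aM; have [bi|bi] := eqVneq b i; rewrite ?bi ?(negPf iM).
      by apply: kill; rewrite ?Mi//; lia.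
    have bM : b != ord_max by rewrite -aM eq_sym.
    by rewrite (negPf bM); apply: kill; rewrite ?bi ?orbT// 1?eq_sym//; lia.
  - have [bi|bi] := eqVneq b i; last have [bM|bM] := eqVneq b ord_max.
    + by rewrite bi (negPf iM); apply: kill; rewrite -?bi ?aM ?orbT//; lia.
    + rewrite bM.
      case: m m0 => // -[|m] _.
        by apply: prod; rewrite -?bM ?eqxx ?orbT.
      by apply: kill; rewrite ?Mi ?aM ?orbT -?bM//; lia.
    + by apply: kill; rewrite ?bi ?aM ?orbT//; lia.
- move=> W Wsub We Wd Ww; apply: (flow_irr (vac_irr vac) Wsub We Wd) => Wv; apply: Ww.
  (* The flowed mode [1] of this current is the original mode [-1], which maps [v] to [w]. *)
  have := We i ord_max 1 v Wv; rewrite flowE (negPf iM) scale0r addr0.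
  by rewrite /root_cochar eqxx (negPf iM) eqxx eq_sym (negPf iM).
Qed.
End SpectralFlow.

(** * Elementary symmetric polynomials of operators *)

Section NewtonOperators.
Variables (F : numFieldType) (V : lmodType F) (P : nat -> {linear V -> V}).

(** All values so far are kept in a list, because each new one depends on all earlier ones. *)
Fixpoint newton_seq (n : nat) : seq (V -> V) :=
  if n is n'.+1 then
    rcons (newton_seq n') (fun w => n'.+1%:R^-1 *:
      \sum_(k < n'.+1) (-1) ^+ k *: P k (nth id (newton_seq n') (n' - k) w))
  else [:: id].

(* Newton's identities: the elementary symmetric polynomials in terms of the
   power sums, [P k] being the one of degree [k.+1]. *)
Definition newton n : V -> V := nth id (newton_seq n) n.

Lemma newton0 w : newton 0 w = w.
Proof. by []. Qed.

Lemma size_newton_seq n : size (newton_seq n) = n.+1.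
Proof. by elim: n => //= n IH; rewrite size_rcons IH. Qed.

Lemma nth_newton_seq n c : (c <= n)%N -> nth id (newton_seq n) c = newton c.
Proof.
elim: n => [|n IH]; first by rewrite leqn0 => /eqP ->.
rewrite leq_eqVlt => /orP[/eqP -> //|cn] /=.
by rewrite nth_rcons size_newton_seq cn IH.
Qed.

Lemma newtonS n w :
  n.+1%:R *: newton n.+1 w = \sum_(k < n.+1) (-1) ^+ k *: P k (newton (n - k) w).
Proof.
rewrite {1}/newton [newton_seq n.+1]/= nth_rcons size_newton_seq ltnn eqxx.
rewrite scalerA divff ?pnatr_eq0// scale1r.
by apply: eq_bigr => k _; rewrite nth_newton_seq// leq_subr.
Qed.

Lemma newton_uniq n w u :
  n.+1%:R *: u = \sum_(k < n.+1) (-1) ^+ k *: P k (newton (n - k) w) ->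
  newton n.+1 w = u.
Proof.
have n0 : n.+1%:R != 0 :> F by rewrite pnatr_eq0.
by rewrite -newtonS => /(scalerI n0).
Qed.

Lemma newton_linear n : linear (newton n).
Proof.
elim/ltn_ind: n => -[|n] IH a u w //; apply: newton_uniq.
rewrite scalerDr !scalerA mulrC -scalerA !newtonS scaler_sumr -big_split.
apply: eq_bigr => k _ /=; rewrite IH ?ltnS ?leq_subr// linearP scalerDr !scalerA.
by rewrite mulrC.
Qed.

HB.instance Definition _ n :=
  GRing.isLinear.Build F V V _ (newton n) (newton_linear n).

Lemma newton_kill v n : (forall k, P k v = 0) -> newton n.+1 v = 0.
Proof.
move=> Pv; elim/ltn_ind: n => n IH; apply: newton_uniq; rewrite scaler0 big1// => k _.
case nk: (n - k)%N => [|m]; first by rewrite Pv scaler0.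
by rewrite IH ?linear0 ?scaler0//; have := ltn_ord k; lia.
Qed.

Lemma newton_commute (y : {linear V -> V}) n w :
  (forall k w, P k (y w) = y (P k w)) -> newton n (y w) = y (newton n w).
Proof.
move=> Py; elim/ltn_ind: n w => -[|n] IH w //; apply: newton_uniq.
rewrite -linearZ /= newtonS linear_sum; apply: eq_bigr => k _.
by rewrite IH ?ltnS ?leq_subr// Py linearZ.
Qed.

(** Here [x m] behaves like the power [z^m] of an additional variable, which adds [z^(k+1)] to the
    power sum [P k]. The elementary symmetric polynomial of degree [n+1] then gains [z] times the
    one of degree [n]. *)
Lemma newton_shift (x : nat -> {linear V -> V}) n w :
  (forall k m w, P k (x m w) = x m (P k w) + x (m + k.+1)%N w) ->
  newton n.+1 (x 0%N w) = x 0%N (newton n.+1 w) + x 1%N (newton n w).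
Proof.
move=> Px; suff: forall m, newton n.+1 (x m w) = x m (newton n.+1 w) + x m.+1 (newton n w) by [].
elim/ltn_ind: n w => n IH w m; apply: newton_uniq.
have -> : \sum_(k < n.+1) (-1) ^+ k *: P k (newton (n - k) (x m w))
   = \sum_(k < n.+1) (-1) ^+ k *: P k (x m (newton (n - k) w))
     + \sum_(k < n) (-1) ^+ k *: P k (x m.+1 (newton (n - k.+1) w)).
  rewrite [LHS]big_ord_recr [X in X + _ = _]/= [X in _ = X + _]big_ord_recr /=.
  rewrite subnn !newton0 addrAC; congr (_ + _).
  rewrite -big_split; apply: eq_bigr => k _ /=.
  have -> : (n - k = (n - k.+1).+1)%N by have := ltn_ord k; lia.
  by rewrite IH ?linearD ?scalerDr//; have := ltn_ord k; lia.
have -> : \sum_(k < n.+1) (-1) ^+ k *: P k (x m (newton (n - k) w))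
   = n.+1%:R *: x m (newton n.+1 w) +
     \sum_(k < n.+1) (-1) ^+ k *: x (m + k.+1)%N (newton (n - k) w).
  rewrite -linearZ newtonS linear_sum -big_split; apply: eq_bigr => k _ /=.
  by rewrite Px scalerDr -linearZ.
have -> : \sum_(k < n) (-1) ^+ k *: P k (x m.+1 (newton (n - k.+1) w))
   = n%:R *: x m.+1 (newton n w) +
     \sum_(k < n) (-1) ^+ k *: x (m + k.+2)%N (newton (n - k.+1) w).
  have -> : n%:R *: x m.+1 (newton n w) =
      x m.+1 (\sum_(k < n) (-1) ^+ k *: P k (newton (n - k.+1) w)).
    case: (n) => [|n']; first by rewrite big_ord0 linear0 scale0r.
    by rewrite -linearZ newtonS.
  rewrite linear_sum -big_split; apply: eq_bigr => k _ /=.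
  by rewrite Px scalerDr -linearZ addSnnS.
(* The two alternating sums cancel up to the term [k = 0] of the first. *)
rewrite big_ord_recl subn0 expr0 scale1r addn1.
have -> : \sum_(i < n) (-1) ^+ lift ord0 i *: x (m + (lift ord0 i).+1)%N (newton (n - lift ord0 i) w)
   = - \sum_(k < n) (-1) ^+ k *: x (m + k.+2)%N (newton (n - k.+1) w).
  rewrite -sumrN; apply: eq_bigr => k _; rewrite lift0 exprS mulN1r.
  by rewrite scaleNr.
rewrite scalerDr -addrA; congr (_ + _); rewrite -[n.+1%:R]/(1 *+ n.+1) mulrS scalerDl scale1r.
by rewrite -addrA; congr (_ + _); rewrite addrC -addrA subrr addr0.
Qed.

(** Models the situation of [k] variables: the polynomial of degree [k] is their product, and those
    of larger degree vanish. *)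
Definition newton_top (k : nat) (u u' : V) : Prop :=
  newton k u = u' /\ forall c, (k < c)%N -> newton c u = 0.

Lemma newton_top_commute (y : {linear V -> V}) k u u' :
  (forall k w, P k (y w) = y (P k w)) ->
  newton_top k u u' -> newton_top k (y u) (y u').
Proof.
by move=> Py [ku u0]; split=> [|c kc]; rewrite newton_commute ?ku// u0// linear0.
Qed.

Lemma newton_top_shift (x : nat -> {linear V -> V}) k u u' :
  (forall k m w, P k (x m w) = x m (P k w) + x (m + k.+1)%N w) ->
  newton_top k u u' -> newton_top k.+1 (x 0%N u) (x 1%N u').
Proof.
move=> Px [ku u0]; split=> [|[//|c] kc].
  by rewrite newton_shift// ku u0// linear0 add0r.
by rewrite newton_shift// !u0 ?linear0 ?addr0//; lia.
Qed.

End NewtonOperators.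

(** * Coloured monomials and their admissibility *)

Section Particles.
Variable l : nat.
Implicit Types (w t : seq ('I_l * nat)) (b : monomial l) (n : {ffun 'I_l -> nat}).

Definition content w : {ffun 'I_l -> nat} := [ffun j => count (fun q => q.1 == j) w].

Definition colour (i : 'I_l) : {ffun 'I_l -> nat} := [ffun j => (j == i) : nat].

Definition factors b : seq ('I_l * nat) :=
  flatten [seq [seq (j, m) | m <- b j] | j <- enum 'I_l].

(** The shift [delta] is arbitrary, because peeling off factors changes it. *)
Definition particle_adm (delta : 'I_l -> nat) b : Prop := forall j,
  sorted (fun p q => p + 2 <= q)%N (b j) /\
  all (fun p => 1 + \sum_(i < l | (i < j)%N) size (b i) + delta j <= p)%N (b j).

Definition push (j : 'I_l) (a : nat) b : monomial l :=
  [ffun i => if i == j then a :: b i else b i].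

Lemma content_nil : content [::] = 0.
Proof. by apply/ffunP => j; rewrite !ffunE. Qed.

Lemma content_cons q w : content (q :: w) = content w + colour q.1.
Proof. by apply/ffunP => j; rewrite !ffunE /= addnC eq_sym. Qed.

Lemma content_cat w t : content (w ++ t) = content w + content t.
Proof. by apply/ffunP => j; rewrite !ffunE count_cat. Qed.

Lemma content_perm w t : perm_eq w t -> content w = content t.
Proof. by move=> /permP wt; apply/ffunP => j; rewrite !ffunE. Qed.

Lemma sum_content w : (\sum_j content w j)%N = size w.
Proof.
elim: w => [|q w IH]; first by rewrite big1// => j _; rewrite content_nil ffunE.
rewrite content_cons (eq_bigr (fun j => (content w j + colour q.1 j)%N)) => [|j _].
  rewrite big_split /= IH (bigD1 q.1)//= big1 => [|j jq]; last by rewrite ffunE (negPf jq).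
  by rewrite ffunE eqxx addn0 addn1.
by rewrite [LHS]ffunE.
Qed.

Lemma count_factors (p : pred ('I_l * nat)) b :
  count p (factors b) = (\sum_j count (fun m => p (j, m)) (b j))%N.
Proof.
rewrite count_flatten -map_comp sumnE big_map big_enum /=; apply: eq_bigr => j _.
by rewrite count_map; apply: eq_count.
Qed.

Lemma content_factors b j : content (factors b) j = size (b j).
Proof.
rewrite ffunE count_factors (bigD1 j)//= eqxx big1 => [|i ij].
  by rewrite addn0 count_predT.
by rewrite (negPf ij) count_pred0.
Qed.

Lemma factors_push j a b : perm_eq (factors (push j a b)) ((j, a) :: factors b).
Proof.
apply/permP => p; rewrite /= !count_factors [LHS](bigD1 j)//= [in RHS](bigD1 j)//=.
rewrite ffunE eqxx /= addnA; congr (_ + _)%N.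
by apply: eq_bigr => i /negPf ij; rewrite ffunE ij.
Qed.

Lemma sum_size_push (i j : 'I_l) a b :
  (\sum_(k < l | (k < i)%N) size (push j a b k) =
   \sum_(k < l | (k < i)%N) size (b k) + (j < i))%N.
Proof.
rewrite big_mkcond [in RHS]big_mkcond [LHS](bigD1 j)//= [in RHS](bigD1 j)//= ffunE eqxx.
rewrite (eq_bigr (fun k : 'I_l => if (k < i)%N then size (b k) else 0%N)) => [|k /negPf kj].
  by case: ifP => _ /=; lia.
by rewrite ffunE kj.
Qed.

(** The new factor adds one to the sum in the initial conditions of the later colours, while in
    colour [j] the difference condition asks for a gap of two; the shift assumed for [b] provides
    both. *)
Lemma push_adm delta (j : 'I_l) b :
  particle_adm (fun i => (delta i + 1 + (i == j))%N) b ->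
  (forall i : 'I_l, (i < j)%N -> b i = [::]) ->
  particle_adm delta (push j (1 + delta j) b).
Proof.
move=> badm b0 i; have [bs ba] := badm i; rewrite ffunE sum_size_push.
have [ij|ij] := eqVneq i j; last first.
  split => //; have [ltij|jlei] := ltnP i j; first by rewrite b0.
  have -> : (j < i)%N by rewrite ltn_neqAle eq_sym ij.
  by apply: sub_all ba => p; rewrite (negPf ij); lia.
have S0 : (\sum_(k < l | (k < i)%N) size (b k) = 0)%N.
  by rewrite big1// => k; rewrite ij => kj; rewrite b0.
rewrite ij ltnn -ij S0 eqxx in ba *; split=> /=.
  by case: (b i) bs ba => //= x s -> /andP[xa _]; rewrite andbT; lia.
by rewrite !addn0 leqnn; apply: sub_all ba => p; lia.
Qed.

Lemma adm_mono (delta delta' : 'I_l -> nat) b :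
  (forall i, (delta i <= delta' i)%N) -> particle_adm delta' b -> particle_adm delta b.
Proof.
move=> dd' badm i; have [bs ba] := badm i; split=> //.
by apply: sub_all ba => p; have := dd' i; lia.
Qed.

(** * Reduction of words to admissible monomials *)

Section Words.
Variables (F : numFieldType) (V : lmodType F) (Y : 'I_l -> nat -> {linear V -> V}).
Hypothesis Ycomm : forall i p j q u, Y i p (Y j q u) = Y j q (Y i p u).

Definition act w (v : V) : V := foldl (fun u q => Y q.1 q.2 u) v w.

Lemma act_cat w t v : act (w ++ t) v = act t (act w v).
Proof. exact: foldl_cat. Qed.

Fact act_linear w : linear (act w).
Proof. by elim: w => //= q w IH a u v; rewrite /= linearP IH. Qed.

HB.instance Definition _ w := GRing.isLinear.Build F V V _ (act w) (act_linear w).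

Lemma act_commute w i p u : act w (Y i p u) = Y i p (act w u).
Proof. by elim: w u => //= q w IH u; rewrite Ycomm IH. Qed.

Lemma act_perm w t v : perm_eq w t -> act w v = act t v.
Proof.
elim: w t v => [|q w IH] t v; first by rewrite perm_sym => /perm_nilP ->.
move=> qwt; have qt : q \in t by rewrite -(perm_mem qwt) mem_head.
have [t1 [t2 tE]] : exists t1 t2, t = t1 ++ q :: t2.
  by case/splitPr: qt => t1 t2; exists t1, t2.
rewrite {}tE {qt} in qwt *; rewrite act_cat /= -act_commute -act_cat; apply: IH.
by rewrite -(perm_cons q) (perm_trans qwt)// -[q :: t2]cat1s perm_catCA.
Qed.

Lemma monomial_vector_factors (rho : affine F l -> V -> V) x v b :
  (forall j m u, Y j m u = rho (aff (x j) (- m%:Z)) u) ->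
  monomial_vector rho x v b = act (factors b) v.
Proof.
move=> Yrho; rewrite /monomial_vector /factors.
elim: (enum _) v => //= j s IH v; rewrite act_cat IH; congr (act _ _).
by elim: (b j) v => //= m r IHr v; rewrite -Yrho IHr.
Qed.

(** Induction on the number of factors and, inside it, on a bound [K] for the modes of the first
    colour [j]. The relations are only assumed modulo a family [U], graded by content, so that the
    inner induction can treat the lowest factor of colour [j] as zero by enlarging [U]. *)
Lemma particle_span (k : nat) (delta : 'I_l -> nat)
    (U : {ffun 'I_l -> nat} -> V -> Prop) v w :
  size w = k -> (forall n, subspace (U n)) ->
  (forall n u i p, U n u -> U (n + colour i) (Y i p u)) ->
  (forall i p, (p <= delta i)%N -> U (colour i) (Y i p v)) ->
  (forall i j N, U (colour i + colour j) (\sum_(p < N.+1) Y i p (Y j (N - p)%N v))) ->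
  exists2 a, lin_span [set b | particle_adm delta b /\ content (factors b) = content w]%classic
               (fun b => act (factors b) v) a & U (content w) (act w v - a).
Proof.
elim: k delta U v w => [|k IH] delta U v w.
  move=> /size0nil -> Usub _ _ _; exists v; last by rewrite subrr; case: (Usub (content [::])).
  have f0 : factors [ffun=> [::]] = [::].
    by rewrite /factors; elim: (enum _) => //= j s; rewrite ffunE.
  apply: (@lin_span_mem _ _ _ _ _ [ffun=> [::]]); rewrite /= f0//.
  by split=> // j; rewrite ffunE.
move=> szw.
have [j jw jmin] : exists2 j, has (fun q => q.1 == j) w & forall i : 'I_l, (i < j)%N -> content w i = 0%N.
  have [q qw] : exists q, q \in w by case: (w) szw => // q ? _; exists q; exact: mem_head.
  have jw0 : has (fun q' => q'.1 == q.1) w by apply/hasP; exists q.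
  case: (@arg_minnP _ q.1 (fun j => has (fun q => q.1 == j) w) (@nat_of_ord l) jw0) => j jw jmin.
  exists j => // i ij; apply/eqP; rewrite ffunE -leqn0 leqNgt -has_count.
  by apply: contraL ij => /jmin; rewrite -leqNgt.
have [K] : exists K, all (fun q => (q.1 == j) ==> (q.2 <= delta j + K)%N) w.
  exists (\sum_(q <- w) q.2)%N; apply/allP => q qw; apply/implyP => _.
  by rewrite (big_rem q qw) /=; lia.
elim: K delta U => [|K IHK] delta U wK Usub Ustab U1 U2.
  exists 0; first by case: (lin_span_subspace [set b | particle_adm delta b /\
    content (factors b) = content w]%classic (fun b => act (factors b) v)).
  (* For [K = 0] some factor of colour [j] has mode at most [delta j] and maps [v] into [U]. *)
  case/hasP: jw => q qw /eqP qj; rewrite subr0.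
  have U1q : U (colour q.1) (Y q.1 q.2 v).
    by apply: U1; have /implyP := allP wK q qw; rewrite qj eqxx addn0; apply.
  have wq := perm_to_rem qw; rewrite (act_perm v wq) (content_perm wq) content_cons /= addrC.
  elim/last_ind: (rem q w) => [|t q' IHt]; first by rewrite content_nil addr0.
  by rewrite -cats1 act_cat content_cat content_cons content_nil add0r addrA; apply: Ustab.
pose v' := Y j (1 + delta j)%N v.
pose Z n := lin_span [set t | content t + colour j = n]%classic (act^~ v').
have Zsub n : subspace (Z n) by exact: lin_span_subspace.
(* [U] is enlarged by all words applied to [v'], so that [delta j] may be raised by one. *)
pose U' n u := exists u0 z, [/\ U n u0, Z n z & u = u0 + z].
pose delta1 i := (delta i + (i == j))%N.
have UU' n u : U n u -> U' n u.
  move=> Uu; exists u, 0; split=> //; last by rewrite addr0.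
  by case: (Zsub n).
have U'sub n : subspace (U' n).
  split; first by apply: UU'; case: (Usub n).
  move=> a _ _ [u [z [Uu Sz ->]]] [u' [z' [Uu' Sz' ->]]].
  exists (a *: u + u'), (a *: z + z'); split; first by case: (Usub n) => _; apply.
    by case: (Zsub n) => _; apply.
  by rewrite scalerDr addrACA.
have U'stab n u i p : U' n u -> U' (n + colour i) (Y i p u).
  move=> [u0 [z [Uu Sz ->]]]; exists (Y i p u0), (Y i p z); split; last by rewrite linearD.
    exact: Ustab.
  apply: (lin_span_min (W := fun z => Z (n + colour i) (Y i p z)) _ _ Sz) => [|t /= tn].
    split; first by rewrite linear0; case: (Zsub (n + colour i)).
    by move=> a x y Sx Sy; rewrite linearP; case: (Zsub (n + colour i)) => _; apply.
  apply: (@lin_span_mem _ _ _ _ _ (t ++ [:: (i, p)])); last by rewrite act_cat.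
  by rewrite /= content_cat content_cons content_nil add0r -tn addrAC.
have U'1 i p : (p <= delta1 i)%N -> U' (colour i) (Y i p v).
  rewrite /delta1; have [pi _|pi] := leqP p (delta i); first exact/UU'/U1.
  have [ij|] := eqVneq i j => pi'; last by lia.
  exists 0, (Y i p v); split; last by rewrite add0r.
    by case: (Usub (colour i)).
  apply: (@lin_span_mem _ _ _ _ _ [::]); first by rewrite /= content_nil add0r ij.
  by rewrite /= /v' -ij; congr (Y _ _ _); move: pi' => /=; lia.
have U'2 i i' N : U' (colour i + colour i') (\sum_(p < N.+1) Y i p (Y i' (N - p)%N v)).
  exact/UU'/U2.
have wK' : all (fun q => (q.1 == j) ==> (q.2 <= delta1 j + K)%N) w.
  by apply: sub_all wK => q; rewrite /delta1 eqxx addn1 addSnnS.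
have [a1 Sa1 [u0 [z [Uu0 Sz az]]]] := IHK delta1 U' wK' U'sub U'stab U'1 U'2.
have dd1 i : (delta i <= delta1 i)%N by rewrite leq_addr.
set S := lin_span _ _; have Ssub : subspace S by exact: lin_span_subspace.
have {}Sa1 : S a1.
  apply: lin_span_min Sa1 => // b [badm bw].
  apply: (@lin_span_mem _ _ _ _ _ b) => //; split=> //.
  exact: adm_mono badm.
(* The part of the remainder in [Z] consists of words with one factor fewer applied to [v']; the
   outer induction reduces these. *)
suff [a2 Sa2 Ua2] : exists2 a, S a & U (content w) (z - a).
  exists (a1 + a2); first exact: subspaceD.
  rewrite opprD addrA az -addrA; exact: subspaceD.
apply: (lin_span_min (W := fun z => exists2 a, S a & U (content w) (z - a)) _ _ Sz) => [|t /= tw].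
  split; first by exists 0; rewrite ?subr0; [case: Ssub|case: (Usub (content w))].
  move=> a x y [ax Sx Ux] [ay Sy Uy]; exists (a *: ax + ay); first by case: Ssub => _; apply.
  by rewrite opprD addrACA -scalerBr; case: (Usub (content w)) => _; apply.
have szt : size t = k.
  apply: succn_inj; rewrite -szw -!sum_content -tw -addn1.
  rewrite -[1%N in LHS](_ : (\sum_i colour j i)%N = _).
    by rewrite -big_split; apply: eq_bigr => i _; rewrite [RHS]ffunE.
  by rewrite (bigD1 j)//= ffunE eqxx big1// => i /negPf ij; rewrite ffunE ij.
pose delta' i := (delta i + 1 + (i == j))%N.
have [||||a Sa Ua] := IH delta' (fun n => U (n + colour j)) v' t szt.
- by move=> n; exact: Usub.
- by move=> n u i p Uu; rewrite addrAC; exact: Ustab.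
- move=> i p; have Uij := Usub (colour i + colour j).
  have small p' q : (p' <= delta i)%N || (q <= delta j)%N ->
      U (colour i + colour j) (Y i p' (Y j q v)).
    case/orP=> h; first by rewrite Ycomm; apply/Ustab/U1.
    by rewrite addrC; apply/Ustab/U1.
  rewrite /delta' /v'; have [pi _|pi] := leqP p (delta i); first by apply: small; rewrite pi.
  have [pi1 _|pi1] := leqP p (delta i).+1.
    (* In this total degree, [delta i + 1] and [delta j + 1] form the only pair of modes that both
       exceed the bounds. *)
    have := U2 i j (delta i + delta j).+2; rewrite (bigD1 (inord p)) ?inordK//=; try lia.
    move=> Us; rewrite (_ : (1 + delta j)%N = ((delta i + delta j).+2 - p)%N); last by lia.
    move: Us; set R := \sum_(q < _ | _) _ => Us; rewrite -[X in U _ X](addrK R).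
    apply: subspaceB => //; apply: subspace_sum => // q _.
    by rewrite -val_eqE /= inordK => [qp|]; [apply: small|]; lia.
  have [ij|] := eqVneq i j => pi2; last by lia.
  (* One degree higher and with equal colours, exactly two terms survive; they are equal by
     commutativity, so division by 2 gives the claim. *)
  subst i; have := U2 j j (delta j + delta j).+3.
  have lt1 : (p < (delta j + delta j).+4)%N by lia.
  have lt3 : (1 + delta j < (delta j + delta j).+4)%N by lia.
  have lt2 : (p.-1 < (delta j + delta j).+4)%N by lia.
  rewrite (bigD1 (inord p)) //= (bigD1 (inord p.-1)) /=; last first.
    by rewrite -val_eqE /= !inordK//; lia.
  rewrite !inordK//.
  rewrite (_ : ((delta j + delta j).+3 - p)%N = (1 + delta j)%N); last by lia.
  rewrite (_ : ((delta j + delta j).+3 - p.-1)%N = p); last by lia.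
  rewrite (_ : p.-1 = (1 + delta j)%N); last by lia.
  rewrite [Y j _ (Y j p v)]Ycomm addrA -mulr2n -scaler_nat.
  set R := \sum_(q < _ | _) _ => Us; set u := Y j p _ in Us *.
  have -> : u = 2^-1 *: (2 *: u + R - R) by rewrite addrK scalerA mulVf ?scale1r// pnatr_eq0.
  apply: subspaceZ => //; apply: subspaceB => //; apply: subspace_sum => // q _.
  by rewrite -!val_eqE /= !inordK// => qp; apply: small; lia.
- move=> i i' N; rewrite (_ : \sum_(p < N.+1) _ = Y j (1 + delta j)%N (\sum_(p < N.+1) Y i p (Y i' (N - p)%N v))).
    exact/Ustab/U2.
  by rewrite linear_sum; apply: eq_bigr => p _; rewrite /v' [RHS]Ycomm; congr (Y _ _ _); exact: Ycomm.
exists a; last by rewrite -tw.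
apply: lin_span_min Sa => // b [badm bt].
have b0 (i : 'I_l) : (i < j)%N -> b i = [::].
  move=> ij; apply/size0nil; rewrite -content_factors bt.
  by have := jmin i ij; rewrite -tw ffunE => /eqP; rewrite addn_eq0 => /andP[/eqP].
apply: (@lin_span_mem _ _ _ _ _ (push j (1 + delta j) b)).
  split; first exact: push_adm.
  by rewrite (content_perm (factors_push _ _ _)) content_cons bt.
by rewrite (act_perm v (factors_push j (1 + delta j) b)).
Qed.
End Words.
End Particles.

(** * Linear independence of the admissible monomials *)

Section ParticleBasis.
Variables (F : numFieldType) (l : nat) (V : lmodType F) (kappa : F).
Local Notation I := 'I_l.+1.
Implicit Types (e : I -> I -> int -> {linear V -> V}) (d : {linear V -> V}).
Implicit Types (b : monomial l) (delta : 'I_l -> nat).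

(* For [delta j = (j < r)] and the currents [e] obtained from the standard module
   by spectral flow, this is x_j(-p) up to a scalar. *)
Definition particle e delta (j : 'I_l) (p : nat) : {linear V -> V} :=
  e (lo j) ord_max ((delta j)%:Z - p%:Z).

Lemma lo_neq_max (j : 'I_l) : lo j != ord_max.
Proof. by rewrite -val_eqE /= ltn_eqF. Qed.

Lemma lo_eq (i j : 'I_l) : (lo i == lo j) = (i == j).
Proof. by rewrite -!val_eqE. Qed.

Lemma root_comm e (i j : 'I_l) m n u : current_comm kappa e ->
  e (lo i) ord_max m (e (lo j) ord_max n u) = e (lo j) ord_max n (e (lo i) ord_max m u).
Proof.
move=> ecomm; rewrite ecomm [_ == lo j]eq_sym [_ == lo i]eq_sym.
rewrite (negPf (lo_neq_max i)) (negPf (lo_neq_max j)) !scale0r subr0 addr0.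
by rewrite !(mul0r, mulr0) subr0 mulr0 if_same scale0r addr0.
Qed.

Lemma particle_comm e delta i p j q u : current_comm kappa e ->
  particle e delta i p (particle e delta j q u) =
  particle e delta j q (particle e delta i p u).
Proof. exact: root_comm. Qed.

Lemma root_act e delta (i : 'I_l) m w u : current_comm kappa e ->
  e (lo i) ord_max m (act (particle e delta) w u) =
  act (particle e delta) w (e (lo i) ord_max m u).
Proof. by move=> ecomm; elim: w u => //= q w IH u; rewrite IH root_comm. Qed.

Lemma eq_act (Y Y' : 'I_l -> nat -> {linear V -> V}) w u :
  (forall i p u, Y i p u = Y' i p u) -> act Y w u = act Y' w u.
Proof. by move=> YY'; elim: w u => //= q w IH u; rewrite YY' IH. Qed.

Lemma particle_kill e d s v delta i p : vacuum kappa e d s v ->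
  (p <= delta i)%N -> particle e delta i p v = 0.
Proof. by move=> vac pi; rewrite /particle (vac_kill vac)//; lia. Qed.

(** Terms in which one of the factors kills [v] drop out, and shifting the indices by [delta] turns
    the rest into a coefficient of a product of two currents. *)
Lemma particle_product_eq0 e d s v delta i j N : vacuum kappa e d s v ->
  \sum_(p < N.+1) particle e delta i p (particle e delta j (N - p)%N v) = 0.
Proof.
move=> vac; have small p q : (p <= delta i)%N || (q <= delta j)%N ->
    particle e delta i p (particle e delta j q v) = 0.
  case/orP=> h; last by rewrite (particle_kill vac h) linear0.
  by rewrite particle_comm ?(particle_kill vac h) ?linear0//; exact: vac_comm vac.
have [Nij|Nij] := leqP N (delta i + delta j); first by rewrite big1// => p _; apply: small; lia.
rewrite -(big_mkord predT (fun p => particle e delta i p (particle e delta j (N - p)%N v))).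
rewrite (big_cat_nat (n := (delta i).+1))//=; last by lia.
rewrite big_nat big1 ?add0r => [|p pi]; last by apply: small; lia.
rewrite (big_cat_nat (n := (N - delta j)%N))//=; try lia.
rewrite [X in _ + X]big_nat [X in _ + X]big1 ?addr0 => [|p pi]; last by apply: small; lia.
rewrite -add1n big_addn.
rewrite -[RHS](root_product_eq0 (N - delta j - delta i)%N vac (lo_neq_max i) (lo_neq_max j));
  rewrite ?eqxx ?orbT// 1?eq_sym ?lo_neq_max//.
by apply: eq_big_nat => q qn; rewrite /particle; congr (e _ _ _ (e _ _ _ _)); lia.
Qed.

Section Separation.
Variables (e : I -> I -> int -> {linear V -> V}) (ecomm : current_comm kappa e).

Lemma cartan_root (i j : 'I_l) (m n : int) u :
  e (lo j) (lo j) m (e (lo i) ord_max n u) =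
  e (lo i) ord_max n (e (lo j) (lo j) m u)
    + (i == j)%:R *: e (lo i) ord_max (m + n) u.
Proof.
rewrite ecomm lo_eq [j == i]eq_sym [ord_max == lo j]eq_sym.
rewrite (negPf (lo_neq_max i)) (negPf (lo_neq_max j)) scale0r subr0.
rewrite !mulr0 subr0 mulr0 if_same scale0r addr0.
by have [->|] := eqVneq i j; rewrite ?scale0r.
Qed.

(** The modes [E_jj(k+1)] act on the factors of colour [j] as power sums. The top elementary
    symmetric polynomial raises each of their modes by one, which amounts to adding one to
    [delta j]. *)
Lemma newton_particle (j : 'I_l) delta k u u' (w : seq ('I_l * nat)) :
  newton_top (fun k => e (lo j) (lo j) k.+1%:Z) k u u' ->
  newton_top (fun k => e (lo j) (lo j) k.+1%:Z) (k + content w j)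
    (act (particle e delta) w u)
    (act (particle e (fun i => (delta i + (i == j))%N)) w u').
Proof.
elim: w k u u' => [|[i p] w IH] k u u' top; first by rewrite content_nil ffunE addn0.
have -> : (k + content ((i, p) :: w) j = (k + (i == j)) + content w j)%N.
  by rewrite !ffunE /= addnA.
apply: IH; rewrite /=; have [ij|ij] := eqVneq i j.
  subst i; rewrite addn1; pose x m := e (lo j) ord_max ((delta j)%:Z - p%:Z + m%:Z).
  have E0 : particle e delta j p u = x 0%N u by rewrite /x addr0.
  have E1 : particle e (fun i => (delta i + (i == j))%N) j p u' = x 1%N u'.
    by rewrite /x /particle eqxx; congr (e _ _ _ _); lia.
  rewrite {}E0 {}E1; apply: newton_top_shift top => c m t.
  rewrite /x cartan_root eqxx scale1r; congr (_ + e _ _ _ _); lia.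
rewrite addn0 [X in newton_top _ _ _ X](_ : _ = particle e delta i p u').
  apply: newton_top_commute top => c t.
  by rewrite /particle cartan_root (negPf ij) scale0r addr0.
by rewrite /particle; congr (e _ _ _ _); rewrite (negPf ij) addn0.
Qed.

Lemma cartan_act (j : 'I_l) delta v (w : seq ('I_l * nat)) :
  e (lo j) (lo j) 0 v = 0 ->
  e (lo j) (lo j) 0 (act (particle e delta) w v)
    = (content w j)%:R *: act (particle e delta) w v.
Proof.
move=> v0; elim/last_ind: w => [|w [i p] IH].
  by rewrite content_nil ffunE scale0r /= v0.
rewrite -cats1 act_cat content_cat content_cons content_nil add0r ffunE /=.
rewrite {1}/particle cartan_root IH linearZ add0r -scalerDl; congr (_ *: _).
by rewrite natrD [colour _ _]ffunE eq_sym.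
Qed.

End Separation.

Definition pop (j : 'I_l) b : monomial l :=
  [ffun i => if i == j then behead (b i) else b i].

Lemma push_pop (j : 'I_l) b a : b j != [::] -> head 0%N (b j) = a -> push j a (pop j b) = b.
Proof.
move=> bj <-; apply/ffunP => i; rewrite !ffunE; case: eqP => // ->.
by case: (b j) bj.
Qed.

(** Converse to [push_adm], for a monomial that contains the lowest factor. *)
Lemma pop_adm delta (j : 'I_l) b : particle_adm delta b ->
  (forall i : 'I_l, (i < j)%N -> b i = [::]) -> b j != [::] ->
  head 0%N (b j) = (1 + delta j)%N ->
  particle_adm (fun i => (delta i + 1 + (i == j))%N) (pop j b).
Proof.
move=> badm b0 bj hb i; have [bs ba] := badm i.
have := sum_size_push i j (1 + delta j) (pop j b); rewrite (push_pop bj hb) => bsum.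
rewrite {}bsum in ba; rewrite ffunE.
have [ij|ij] := eqVneq i j; last first.
  split=> //; have [ltij|jlei] := ltnP i j; first by rewrite b0.
  have ji : (j < i)%N by rewrite ltn_neqAle eq_sym ij.
  by apply: sub_all ba => p; rewrite ji; lia.
subst i; rewrite ltnn in ba.
case: (b j) bj hb bs ba => // x s _ /= -> xs /andP[_ sa]; split; first exact: path_sorted xs.
have tr : transitive (fun p q => p + 2 <= q)%N by move=> p q r; lia.
have := order_path_min tr xs.
rewrite big1 ?addn0; last by move=> k kj; rewrite ffunE -val_eqE ltn_eqF// b0.
by apply: sub_all => p; lia.
Qed.

(** Induction on the number of factors and, inside it, on a bound [K] for the modes of the first
    colour [j], as for spanning. *)
Lemma particle_free_content (N : nat) e d s v delta (n : {ffun 'I_l -> nat})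
    (t : seq (monomial l)) (c : monomial l -> F) :
  vacuum kappa e d s v -> (\sum_j n j)%N = N -> uniq t ->
  (forall b, b \in t -> particle_adm delta b /\ content (factors b) = n) ->
  \sum_(b <- t) c b *: act (particle e delta) (factors b) v = 0 ->
  forall b, b \in t -> c b = 0.
Proof.
elim: N e d s v delta n t c => [|N IH] e d s v delta n t c vac.
  move=> n0 ut tP sum0 b bt.
  have nil0 b' : b' \in t -> factors b' = [::].
    by move=> /tP[_ bn]; apply: size0nil; rewrite -sum_content bn.
  have bE b' : b' \in t -> b' = [ffun=> [::]].
    move=> b't; apply/ffunP => j; rewrite ffunE; apply: size0nil.
    by rewrite -content_factors nil0// content_nil ffunE.
  move: sum0; rewrite (bigD1_seq b)//= nil0//= big1_seq ?addr0.
    by move=> /eqP; rewrite scaler_eq0 (negPf (vac_neq0 vac)) orbF => /eqP.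
  by move=> b' /andP[b'b b't]; rewrite (bE _ b't) (bE _ bt) eqxx in b'b.
move=> nN; have [j nj jmin] : exists2 j, n j != 0%N & forall i : 'I_l, (i < j)%N -> n i = 0%N.
  have [j0 nj0] : exists j, n j != 0%N.
    apply/existsP; apply: contra_eqT nN => /existsPn n0.
    by rewrite big1// => j _; apply/eqP/negPn.
  case: (@arg_minnP _ j0 (fun j => n j != 0%N) (@nat_of_ord l) nj0) => j nj jmin.
  exists j => // i ij; apply/eqP; apply: contraTT ij => /jmin.
  by rewrite -leqNgt.
move=> ut tP sum0.
have [K tK] : exists K, forall b, b \in t -> all (fun p => p <= delta j + K)%N (b j).
  exists (\sum_(b <- t) \sum_(p <- b j) p)%N => b bt; apply/allP => p pb.
  by rewrite (big_rem b bt) /= (big_rem p pb) /=; lia.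
elim: K delta t ut tP tK sum0 => [|K IHK] delta t ut tP tK sum0.
  (* For [K = 0] there is no such monomial: admissibility puts its first factor of colour [j] above
     [delta j]. *)
  move=> b bt; have [/(_ j)[_ ba] bn] := tP b bt; have := tK b bt.
  have : size (b j) != 0%N by rewrite -content_factors bn.
  by case: (b j) ba => //= x r /andP[xa _] _ /andP[xb _]; lia.
have bj b : b \in t -> b j != [::].
  by move=> /tP[_ bn]; apply: contraNneq nj => b0; rewrite -bn content_factors b0.
have b0 b (i : 'I_l) : b \in t -> (i < j)%N -> b i = [::].
  by move=> /tP[_ bn] ij; apply: size0nil; rewrite -content_factors bn jmin.
have ecomm := vac_comm vac.
pose delta1 i := (delta i + (i == j))%N.
pose low b := head 0%N (b j) == (1 + delta j)%N.
have first_factor (dl : 'I_l -> nat) b : b \in t -> low b ->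
    act (particle e dl) (factors b) v =
    act (particle e dl) (factors (pop j b)) (particle e dl j (1 + delta j)%N v).
  move=> bt /eqP lb; rewrite -{1}(push_pop (bj b bt) lb).
  by rewrite (act_perm _ _ (factors_push j _ _))// => *; exact: particle_comm.
(* The Newton operator of degree [n j] turns the relation into the same one for [delta1]. *)
have shifted : \sum_(b <- t) c b *: act (particle e delta1) (factors b) v = 0.
  pose T := newton (fun k => e (lo j) (lo j) k.+1%:Z) (n j).
  have : T (\sum_(b <- t) c b *: act (particle e delta) (factors b) v) = 0.
    by rewrite /T sum0 linear0.
  rewrite /T linear_sum => E; rewrite -[RHS]E; apply: eq_big_seq => b bt; rewrite linearZ /=; congr (_ *: _).
  have top0 : newton_top (fun k => e (lo j) (lo j) k.+1%:Z) 0 v v.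
    by split=> // -[//|k] _; apply: newton_kill => k'; rewrite /= (vac_kill vac).
  have [_ bn] := tP b bt.
  by have [+ _] := newton_particle ecomm delta (factors b) top0; rewrite bn.
(* In the shifted relation the monomials with the lowest factor vanish, and the other ones are
   admissible for [delta1]. *)
have high b : b \in t -> ~~ low b -> c b = 0.
  move=> bt hb; apply: (IHK delta1 [seq b <- t | ~~ low b]); last by rewrite mem_filter hb.
  - exact: filter_uniq.
  - move=> b'; rewrite mem_filter => /andP[hb' b't]; have [badm bn] := tP b' b't.
    split=> // i; have [bs ba] := badm i; split=> //; rewrite /delta1.
    have [ij|] := eqVneq i j; last by rewrite addn0.
    subst i; move: bs ba hb'; rewrite /low.
    case: (b' j) => //= x r xr /andP[xa _] hx.
    have tr : transitive (fun p q => p + 2 <= q)%N by move=> p q z; lia.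
    have := order_path_min tr xr; rewrite big1 ?addn0 in xa *.
      by rewrite andbC => ra; apply/andP; split; [apply: sub_all ra => p|]; lia.
    by move=> i ij; rewrite b0.
  - move=> b'; rewrite mem_filter => /andP[_ /tK]; apply: sub_all => p.
    by rewrite /delta1 eqxx; lia.
  - rewrite -[RHS]shifted [RHS](bigID low) /= big_filter [X in _ = X + _]big1_seq ?add0r//.
    move=> b' /andP[lb' b't]; rewrite first_factor//.
    by rewrite (particle_kill vac) ?linear0 ?scaler0// /delta1 eqxx; lia.
pose delta' i := (delta i + 1 + (i == j))%N.
move=> b bt; have [lb|] := boolP (low b); last exact: high.
pose lam := root_cochar (lo j).
pose e' := flow lam 0 e.
pose v' := e (lo j) ord_max (-1) v.
have vac' : vacuum kappa e' (flow_d lam e d) (s + 1) v'.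
  exact: vacuum_next vac (lo_neq_max j).
(* The flow lowers the modes of colour [i] by [1 + (i == j)], which [delta'] compensates. *)
have partE i p u : particle e delta i p u = particle e' delta' i p u.
  rewrite /particle /e' flowE (negPf (lo_neq_max i)) scale0r addr0.
  congr (e _ _ _ _); rewrite /lam /root_cochar lo_eq (negPf (lo_neq_max i)).
  by rewrite eqxx [ord_max == _]eq_sym (negPf (lo_neq_max j)) /delta'; lia.
have vE : particle e delta j (1 + delta j)%N v = v'.
  by rewrite /particle /v'; congr (e _ _ _ _); lia.
have pushK b' : b' \in t -> low b' -> push j (1 + delta j) (pop j b') = b'.
  by move=> b't /eqP; apply: push_pop; exact: bj.
rewrite -(pushK b bt lb).
(* With their common lowest factor absorbed into [v'], the remaining monomials satisfy a relation
   with one factor fewer. *)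
apply: (IH e' _ _ v' delta' [ffun i => n i - (i == j)]%N
  [seq pop j b | b <- t & low b] (fun b => c (push j (1 + delta j) b)) vac').
- apply: succn_inj; rewrite -nN [RHS](bigD1 j)//= (bigD1 j)//= ffunE eqxx.
  rewrite -addSn subn1 prednK ?lt0n//; congr (_ + _)%N.
  by apply: eq_bigr => i /negPf ij; rewrite ffunE ij subn0.
- rewrite map_inj_in_uniq ?filter_uniq// => b1 b2.
  rewrite !mem_filter => /andP[l1 t1] /andP[l2 t2] E.
  by rewrite -(pushK b1)// -(pushK b2)// E.
- move=> _ /mapP[b1 + ->]; rewrite mem_filter => /andP[l1 t1].
  have [adm1 n1] := tP b1 t1; split.
    by apply: pop_adm => //; [move=> i; exact: b0|exact: bj|exact/eqP].
  apply/ffunP => i; rewrite content_factors !ffunE -n1 content_factors.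
  by case: eqP => [->|_]; rewrite ?subn1 ?size_behead ?subn0.
- rewrite big_map big_filter -[RHS]sum0 [RHS](bigID low) /=.
  rewrite [X in _ = _ + X]big1_seq ?addr0; last first.
    by move=> b1 /andP[l1 t1]; rewrite high// scale0r.
  rewrite big_seq_cond [RHS]big_seq_cond; apply: eq_bigr => b1 /andP[t1 l1].
  rewrite pushK// [in RHS]first_factor// vE; congr (_ *: _).
  by apply: eq_act => i p u; rewrite partE.
- by apply: map_f; rewrite mem_filter lb.
Qed.

(** [E_jj(0)] counts the factors of colour [j], so separating its eigenvalues for every [j] splits a
    relation by content. *)
Lemma particle_free e d s v delta : vacuum kappa e d s v ->
  lin_indep (particle_adm delta) (fun b => act (particle e delta) (factors b) v).
Proof.
move=> vac t c ut tP sum0 b bt.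
pose same js (b' : monomial l) := all (fun j => size (b' j) == size (b j)) js.
have sep (js : seq 'I_l) :
  \sum_(b' <- t | same js b') c b' *: act (particle e delta) (factors b') v = 0.
  elim: js => [|j js IH] /=; first by rewrite -[RHS]sum0.
  rewrite -big_filter in IH.
  have := eigen_separation (A := e (lo j) (lo j) 0) (a := fun b' : monomial l => (size (b' j))%:R)
    (size (b j))%:R _ IH.
  rewrite big_filter_cond => E; rewrite -[RHS]E => [|b' _].
    by apply: eq_bigl => b'; rewrite eqr_nat andbC.
  rewrite linearZ /= (cartan_act (vac_comm vac)) ?(vac_kill vac)//.
  by rewrite content_factors !scalerA mulrC.
have := sep (enum 'I_l); rewrite -big_filter => sum1.
apply: (particle_free_content vac (erefl _) _ _ sum1).
- exact: filter_uniq.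
- move=> b'; rewrite mem_filter => /andP[/allP b'b b't]; split; first exact: tP.
  apply/ffunP => j; rewrite content_factors.
  by have /eqP -> := b'b j (mem_enum _ j); rewrite -content_factors.
- by rewrite mem_filter bt andbT; apply/allP.
Qed.

End ParticleBasis.

(** * The projection of gl onto sl, root spaces and integrability *)

Section TracelessPart.
Variables (F : numFieldType) (l : nat).
Local Notation sl := (sl F l).

Definition traceless_part (y : 'M[F]_l.+1) : sl := sl_of_mx (y - (\tr y / l.+1%:R)%:M).

Lemma traceless_partE y : sl_mx (traceless_part y) = y - (\tr y / l.+1%:R)%:M.
Proof.
rewrite sl_of_mxK// raddfB /= mxtrace_scalar -[_ *+ _]mulr_natr divfK ?subrr//.
by rewrite pnatr_eq0.
Qed.

Lemma traceless_partP a y z :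
  traceless_part (a *: y + z) = a *: traceless_part y + traceless_part z.
Proof.
apply/val_inj; rewrite /= !traceless_partE mxtraceD mxtraceZ.
rewrite mulrDl raddfD /= -mulrA -scale_scalar_mx scalerBr opprD addrACA.
by [].
Qed.

Lemma traceless_part0 : traceless_part 0 = 0.
Proof. by apply/val_inj; rewrite /= traceless_partE mxtrace0 mul0r raddf0 subr0. Qed.

Lemma traceless_part_id (y : sl) : traceless_part (sl_mx y) = y.
Proof.
apply/val_inj; rewrite /= traceless_partE.
by case: y => y /= /eqP ->; rewrite mul0r raddf0 subr0.
Qed.

Lemma traceless_bracket y z :
  sl_bracket (traceless_part y) (traceless_part z) = traceless_part (y *m z - z *m y).
Proof.
have tr0 : \tr (y *m z - z *m y) = 0 by rewrite raddfB /= mxtrace_mulC subrr.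
apply/val_inj; rewrite /= !traceless_partE tr0 mul0r raddf0 subr0 !mulmxBl !mulmxBr !mul_mx_scalar !mul_scalar_mx.
rewrite !scale_scalar_mx [_ / _ * (\tr y / _)]mulrC !opprD !opprK !addrA.
rewrite (ACl (1 * 5 * (2 * 7) * (3 * 6) * (4 * 8)))%AC /=.
by rewrite !addNr subrr !addr0.
Qed.

(** The scalar parts produce the factor [1/(l+1)], which is the value of [kappa]. *)
Lemma traceless_form y z : sl_form (traceless_part y) (traceless_part z) =
  \tr (y *m z) - l.+1%:R^-1 * \tr y * \tr z.
Proof.
have l0 : l.+1%:R != 0 :> F by rewrite pnatr_eq0.
rewrite /sl_form !traceless_partE mulmxBl !mulmxBr !mul_mx_scalar !mul_scalar_mx.
rewrite !raddfB /= !mxtraceZ mxtrace_scalar -[(_ / _) *+ _]mulr_natr.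
by move: (l.+1%:R : F) l0 => L L0; field.
Qed.

End TracelessPart.

Section RootSpaces.
Variables (F : numFieldType) (l : nat).
Local Notation sl := (sl F l).

Lemma gammaE (i : 'I_l) (h : sl) :
  gamma i h = sl_mx h (lo i) (lo i) - sl_mx h ord_max ord_max.
Proof.
pose g (n : nat) := - sl_mx h (inord n) (inord n).
have gE (k : 'I_l.+1) : sl_mx h k k = - g k by rewrite /g inord_val opprK.
transitivity (\sum_(i <= k < l) (g k.+1 - g k)); last first.
  by rewrite telescope_sumr ?gE /= 1?addrC ?opprK// ltnW.
rewrite big_geq_mkord; apply: eq_bigr => k _; rewrite /alpha (gE (lo k)) (gE (hi k)) [LHS]addrC.
by rewrite !opprK /g lift0.
Qed.

Lemma cartan_bracket (h z : sl) a b : cartan h ->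
  sl_mx (sl_bracket h z) a b = (sl_mx h a a - sl_mx h b b) * sl_mx z a b.
Proof.
move=> hC; have /is_diag_mxP hd : is_diag_mx (sl_mx h) by [].
rewrite !mxE (bigD1 a)//= big1 => [|k ka]; last first.
  by rewrite hd ?mul0r// eq_sym.
rewrite (bigD1 b)//= big1 => [|k kb]; last by rewrite hd ?mulr0.
by ring.
Qed.

(** Bracketing with the traceless part of [E_cc] for each [c] compares the weight of a nonzero entry
    [(a, b)] with [gamma i]; only the entry [(lo i, ord_max)] passes. *)
Lemma root_space_gamma (i : 'I_l) (z : sl) : root_space (gamma i) z ->
  z = sl_mx z (lo i) ord_max *: traceless_part (delta_mx (lo i) ord_max).
Proof.
move=> zg; have iM : lo i != ord_max by exact: lo_neq_max.
have z0 a b : (a, b) != (lo i, ord_max) -> sl_mx z a b = 0.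
  move=> ab; apply/eqP; apply: contraNT ab => zab.
  have E c : (c == a)%:R - (c == b)%:R = (c == lo i)%:R - (c == ord_max)%:R :> F.
    have hc : is_diag_mx (sl_mx (traceless_part (delta_mx c c : 'M[F]_l.+1))).
      apply/is_diag_mxP => p q; rewrite traceless_partE !mxE val_eqE.
      move=> pq; rewrite (negPf pq) mulr0n subr0; case: andP => // -[/eqP pc /eqP qc].
      by rewrite pc qc eqxx in pq.
    have := congr1 (fun y => sl_mx y a b) (zg _ hc); rewrite (cartan_bracket _ _ _ hc).
    rewrite gammaE -[sl_mx (_ *: z)]/(_ *: sl_mx z) [RHS]mxE => /(mulIf zab).
    rewrite !traceless_partE !mxE !eqxx !mulr1n !andbb ![_ == c]eq_sym.
    have sh (p q k : F) : p - k - (q - k) = p - q by ring.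
    by rewrite !sh.
  have sub1 (p q : bool) : p%:R - q%:R = 1 :> F -> p && ~~ q.
    case: p q => -[] //= /eqP; rewrite ?subrr ?sub0r 1?eq_sym ?oner_eq0//.
    by rewrite -addr_eq0 -mulr2n pnatr_eq0.
  have := E (lo i); rewrite eqxx (negPf iM) subr0 => /sub1 /andP[/eqP <- _].
  have := E ord_max; rewrite eqxx eq_sym [ord_max == lo i]eq_sym (negPf iM) sub0r.
  move=> /(congr1 -%R); rewrite opprB opprK => /sub1 /andP[/eqP <- _].
  exact: eqxx.
apply/val_inj; rewrite /= -[RHS]/(_ *: sl_mx _) traceless_partE mxtrace_delta (negPf iM).
apply/matrixP => a b; rewrite !mxE mul0r mul0rn subr0.
case: andP => [[/eqP -> /eqP ->]|/andP ab]; first by rewrite mulr1.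
by rewrite mulr0 z0.
Qed.

End RootSpaces.

(** The sl_2 argument with [f = E_ba(-m)] on a vector of weight zero killed by [E_ab(m)]: applying
    [E_ab(m)] to [f^(n+1) v] gives [-(n+1) n f^n v], so the least power of [f] that kills [v] is at
    most the first. *)
Lemma lowering_kill (F : numFieldType) (l : nat) (V : lmodType F) (kappa : F)
    (e : 'I_l.+1 -> 'I_l.+1 -> int -> {linear V -> V}) v a b m :
  current_comm kappa e -> a != b -> e a b m v = 0 ->
  e a a 0 v - e b b 0 v + m%:~R *: v = 0 ->
  (exists n, iter n (e b a (- m)) v = 0) -> e b a (- m) v = 0.
Proof.
move=> ecomm ab Ev Hv nil; set f := e b a (- m).
pose H w := e a a 0 w - e b b 0 w + m%:~R *: w.
have EF w : e a b m (f w) = f (e a b m w) + H w.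
  rewrite /f ecomm !eqxx !scale1r subrr eqxx (negPf ab) !mul1r /H.
  by rewrite mulr0 mul0r subr0 mulr1 -!addrA.
have HF w : H (f w) = f (H w) - 2%:R *: f w.
  have faa : e a a 0 (f w) = f (e a a 0 w) - f w.
    rewrite /f [LHS]ecomm (negPf ab) eqxx scale0r scale1r addr0 mul0r if_same scale0r.
    by rewrite addr0 add0r.
  have fbb : e b b 0 (f w) = f (e b b 0 w) + f w.
    rewrite /f [LHS]ecomm (negPf ab) eqxx scale0r scale1r subr0 mul0r if_same scale0r.
    by rewrite addr0 add0r.
  rewrite /H faa fbb !linearD linearN linearZ /= scaler_nat mulr2n !opprD !addrA.
  by rewrite (ACl (1 * 3 * 5 * 2 * 4))%AC.
have HFn n : H (iter n f v) = (- (2 * n)%:R) *: iter n f v.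
  elim: n => [|n IH]; first by rewrite muln0 oppr0 scale0r.
  rewrite iterS HF IH linearZ -scalerBl.
  by congr (_ *: _); rewrite -opprD -natrD addnC -mulnS.
have EFn n : e a b m (iter n.+1 f v) = (- (n.+1 * n)%:R) *: iter n f v.
  elim: n => [|n IH]; first by rewrite /= EF Ev linear0 /H Hv muln0 oppr0 scale0r addr0.
  rewrite iterS EF IH HFn linearZ -iterS -scalerDl; congr (_ *: _).
  by rewrite -opprD -natrD; congr (- _%:R); lia.
apply/eqP; apply: contraTT isT => fv.
have ex : exists n, iter n f v == 0 by have [n nv] := nil; exists n; apply/eqP.
case: (ex_minnP ex) => -[|[|n]] nv nmin.
- by move: fv; rewrite /f (eqP (nv : v == 0)) linear0 eqxx.
- by rewrite /= (negPf fv) in nv.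
have := EFn n.+1; rewrite (eqP nv) linear0 => /esym/eqP.
rewrite scaler_eq0 oppr_eq0 pnatr_eq0 muln_eq0 /= => E.
by have := nmin n.+1 E; rewrite ltnn.
Qed.

(** [E_ab(m+n)] is the commutator of the two modes that kill [v]. *)
Lemma bracket_kill (F : numFieldType) (l : nat) (V : lmodType F) (kappa : F)
    (e : 'I_l.+1 -> 'I_l.+1 -> int -> {linear V -> V}) v a b c m n :
  current_comm kappa e -> a != b -> e a c m v = 0 -> e c b n v = 0 ->
  e a b (m + n) v = 0.
Proof.
move=> ecomm ab ac cb; have := ecomm a c c b m n v.
rewrite ac cb !linear0 eqxx [b == a]eq_sym (negPf ab) scale1r scale0r subr0 add0r.
rewrite mulr0 sub0r -mulrA -natrM mulnb.
have -> : (a == c) && (c == b) = false.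
  by apply: contraNF ab => /andP[/eqP -> /eqP ->].
by rewrite mulr0 oppr0 mulr0 if_same scale0r addr0 => <-.
Qed.

(** * The highest weight vector of the standard module as a vacuum *)

Section StandardModule.
Variables (F : numFieldType) (l r : nat) (V : lmodType F).
Variables (rho : affine F l -> V -> V) (v : V).
Hypotheses (l_gt0 : (0 < l)%N) (rl : (r <= l)%N).
Hypothesis std : standard_module rho (@Lambda F l r) v.
Local Notation I := 'I_l.+1.
Local Notation sl := (sl F l).

Let rhoP a u w z : rho (a *: u + w) z = a *: rho u z + rho w z.
Proof. by have [[h _ _] _ _ _ _] := std. Qed.

Let rho_linear u : linear (rho u).
Proof. by have [[_ h _] _ _ _ _] := std => a z w; rewrite h. Qed.

HB.instance Definition _ u := GRing.isLinear.Build F V V _ (rho u) (rho_linear u).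

Let rho_bracket u w z : rho (aff_bracket u w) z = rho u (rho w z) - rho w (rho u z).
Proof. by have [[_ _ h] _ _ _ _] := std. Qed.

Let rhoD u w z : rho (u + w) z = rho u z + rho w z.
Proof. by rewrite -[u]scale1r rhoP !scale1r. Qed.

Let rho0 z : rho 0 z = 0.
Proof. by apply: (addrI (rho 0 z)); rewrite -rhoD !addr0. Qed.

Let rhoZ a u z : rho (a *: u) z = a *: rho u z.
Proof. by rewrite -[a *: u]addr0 rhoP rho0 addr0. Qed.

Let rho_sum (J : Type) (s : seq J) (f : J -> affine F l) z :
  rho (\sum_(i <- s) f i) z = \sum_(i <- s) rho (f i) z.
Proof. by elim: s => [|i s IH]; rewrite ?big_nil ?rho0// !big_cons rhoD IH. Qed.

Let aff_linear a (x y : sl) m : aff (a *: x + y) m = a *: aff x m + aff y m.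
Proof.
congr (_, _, _).
- apply/val_inj/funext => k /=.
  by rewrite -[RHS]/(a *: (if k == m then x else 0) + (if k == m then y else 0));
    case: eqP; rewrite ?scaler0 ?addr0.
- by rewrite addr0 [RHS]mulr0.
- by rewrite addr0 [RHS]mulr0.
Qed.

Let rho_affP a (x y : sl) m z : rho (aff (a *: x + y) m) z = a *: rho (aff x m) z + rho (aff y m) z.
Proof. by rewrite aff_linear rhoP. Qed.

Let hwv_neq0 : v != 0.
Proof. by have [_ _ _ [h _ _] _] := std. Qed.

Let hwv_cartan h : aff_cartan h -> rho h v = Lambda r h *: v.
Proof. by have [_ _ _ [_ + _] _] := std; apply. Qed.

Let hwv_nplus u : aff_nplus u -> rho u v = 0.
Proof. by have [_ _ _ [_ _ +] _] := std; apply. Qed.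

(** The level is one: [c] fixes [v], is central, and [v] generates the module. *)
Let rho_c z : rho aff_c z = z.
Proof.
have cv : rho aff_c v = v.
  rewrite hwv_cartan; last by split=> //; apply/is_diag_mxP => i j _; rewrite mxE.
  by rewrite /Lambda /omega /c_part /= big1 ?addr0 ?scale1r// => k _; rewrite mxE.
have : envelope_orbit rho [set: affine F l]%classic v z.
  by have [_ _ _ _ ->] := std.
apply: (lin_span_min (W := fun z => rho aff_c z = z)).
  by split=> [|a u w cu cw]; rewrite ?linear0// rho_linear cu cw.
move=> s _ /=; elim: s => //= u s IH.
by apply/eqP; rewrite -subr_eq0 -{2}IH -rho_bracket aff_bracket_c rho0.
Qed.

Definition gl_current (a b : I) (m : int) : {linear V -> V} :=
  rho (aff (traceless_part (delta_mx a b)) m).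

Let rho_aff0 m z : rho (aff 0 m) z = 0.
Proof. by apply: (addrI (rho (aff 0 m) z)); rewrite -{1}[rho _ z]scale1r -rho_affP scaler0 !addr0. Qed.

Lemma gl_current_comm : current_comm l.+1%:R^-1 gl_current.
Proof.
move=> a b c d m n w; rewrite /gl_current /=.
set y := delta_mx a b; set z := delta_mx c d.
have -> : rho (aff (traceless_part y) m) (rho (aff (traceless_part z) n) w) =
  rho (aff (traceless_part z) n) (rho (aff (traceless_part y) m) w) +
  rho (aff_bracket (aff (traceless_part y) m) (aff (traceless_part z) n)) w.
  by rewrite rho_bracket addrC subrK.
rewrite aff_bracket_mono traceless_bracket traceless_form rhoD rhoZ rho_c addrA.
rewrite -!addrA; congr (_ + _); rewrite addrA.
rewrite {}/y {}/z !mul_delta_mx_cond -!scaler_nat !mxtraceZ !mxtrace_delta.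
congr (_ + _); last first.
  by congr (_ *: _); case: ifP => // _; rewrite ?mxtraceZ ?mxtrace_delta [a == d]eq_sym.
have -> p q (A B : 'M[F]_l.+1) : traceless_part (p *: A - q *: B)
    = p *: traceless_part A + (- q *: traceless_part B + 0).
  by rewrite -scaleNr -[- q *: B]addr0 !traceless_partP traceless_part0.
by rewrite !rho_affP rho_aff0 addr0 scaleNr.
Qed.

Let sum_aff (s : seq int) (f : int -> sl) :
  \sum_(m <- s) aff (f m) m = (\sum_(m <- s) lmono (f m) m, 0, 0).
Proof.
elim: s => [|m s IH]; first by rewrite !big_nil.
by rewrite !big_cons IH; congr (_, _, _); rewrite /= addr0.
Qed.

Let laurent_expand (f : laurent sl) (s : seq int) :
  uniq s -> (forall m, f m != 0 -> m \in s) -> f = \sum_(m <- s) lmono (f m) m.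
Proof.
move=> us fs; apply/val_inj/funext => k /=.
have -> : (\sum_(m <- s) lmono (f m) m : laurent sl) k = \sum_(m <- s) lmono (f m) m k.
  by elim: (s) => [|m s' IH]; rewrite ?big_nil// !big_cons -IH.
have [ks|ks] := boolP (k \in s).
  by rewrite (bigD1_seq k)//= eqxx big1 ?addr0// => m /negPf mk; rewrite eq_sym mk.
rewrite big1_seq => [|m /andP[_ ms]]; first by apply/eqP; apply: contraNT ks => /fs.
by rewrite /= ifF//; apply: contraNF ks => /eqP ->.
Qed.

Lemma rho_decomp u (s : seq int) z :
  uniq s -> (forall m, loop_part u m != 0 -> m \in s) ->
  rho u z = \sum_(m <- s) rho (aff (loop_part u m) m) z + c_part u *: z + d_part u *: rho aff_d z.
Proof.
move=> us su.
have E : u = \sum_(m <- s) aff (loop_part u m) m + c_part u *: aff_c + d_part u *: aff_d.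
  rewrite sum_aff -(laurent_expand us su); case: u su => [[f x] y] /= su.
  congr (_, _, _); rewrite /= /c_part /d_part /=.
  - by rewrite !scaler0 !addr0.
  - by rewrite add0r [x *: _]mulr1 [y *: _]mulr0 addr0.
  - by rewrite add0r [x *: _]mulr0 [y *: _]mulr1 add0r.
by rewrite {1}E !rhoD !rhoZ rho_sum rho_c.
Qed.

Let finite_loop (u : affine F l) :
  exists s : seq int, uniq s /\ forall m, loop_part u m != 0 -> m \in s.
Proof.
have /asboolP/finite_seqP[s sE] := valP (loop_part u).
exists (undup s); split=> [|m um]; first exact: undup_uniq.
by rewrite mem_undup; have : [set` s]%classic m by rewrite -sE.
Qed.

(** Every element acts through finitely many modes, [d] and the scalar [c], so such a [W] is a
    submodule. *)
Lemma gl_current_irr (W : V -> Prop) : subspace W ->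
  (forall a b m w, W w -> W (gl_current a b m w)) -> (forall w, W w -> W (rho aff_d w)) ->
  ~ W v -> forall w, W w -> w = 0.
Proof.
move=> Wsub We Wd Wv.
have Waff (y : sl) m w : W w -> W (rho (aff y m) w).
  move=> Ww; rewrite -[y]traceless_part_id.
  elim/mx_linear_ind: (sl_mx y) => [|a y1 y2 W1 W2|a b]; last exact: We.
    by rewrite traceless_part0 rho_aff0; case: Wsub.
  by rewrite traceless_partP rho_affP; case: Wsub => _; apply.
have Wsubm : is_submodule rho W.
  split; [by case: Wsub|by case: Wsub|move=> u w Ww].
  have [s [us su]] := finite_loop u.
  rewrite (rho_decomp w us su); apply: subspaceD => //; last by apply: subspaceZ => //; exact: Wd.
  apply: subspaceD => //; last exact: subspaceZ.
  by apply: subspace_sum => // m _ _; exact: Waff.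
have [_ [_ irr] _ _ _] := std.
have [->|WT] := irr W Wsubm; first by [].
by case: Wv; rewrite WT.
Qed.

Lemma gl_current_pos a b m : 0 < m -> gl_current a b m v = 0.
Proof.
move=> m0; apply: hwv_nplus; split=> //= [k k0|i j _].
  by rewrite /= lt_eqF// (lt_trans k0).
by rewrite eq_sym gt_eqF//= mxE.
Qed.

Lemma gl_current_upper (a b : I) : (a < b)%N -> gl_current a b 0 v = 0.
Proof.
move=> ab; have aNb : a != b by rewrite -val_eqE ltn_eqF.
apply: hwv_nplus; split=> //= [k k0|i j ji]; first by rewrite /= lt_eqF.
rewrite /= traceless_partE mxtrace_delta (negPf aNb) !mxE mul0r mul0rn subr0.
by case: andP => // -[/eqP ia /eqP jb]; move: ji; rewrite ia jb leqNgt ab.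
Qed.

(** The subtracted [r/(l+1)] is [omega r] at the scalar part of [E_aa]. *)
Lemma gl_current_diag (a : I) :
  gl_current a a 0 v = ((a < r)%N%:R - r%:R / l.+1%:R) *: v.
Proof.
rewrite /gl_current /= hwv_cartan; last first.
  split=> [|m /negPf m0 /=]; last by rewrite m0.
  apply/is_diag_mxP => i j ij; rewrite /= traceless_partE !mxE val_eqE in ij *.
  by rewrite (negPf ij) mulr0n subr0; case: andP => // -[/eqP ia /eqP ja]; rewrite ia ja eqxx in ij.
congr (_ *: _); rewrite /Lambda /c_part /= add0r /omega.
rewrite (eq_bigr (fun k : I => (a == k)%:R - l.+1%:R^-1)) => [|k _]; last first.
  by rewrite traceless_partE mxtrace_delta !mxE !eqxx andbb mulr1n div1r eq_sym.
rewrite sumrB sumr_const mulr_natl; congr (_ - _ *+ _).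
  rewrite big_mkcond (bigD1 a)//= eqxx big1 ?addr0 => [|k /negPf ka]; first by case: ifP.
  by rewrite eq_sym ka if_same.
rewrite -[RHS](card_ord r) -!sum1_card.
rewrite -(big_ord_widen_cond _ predT (fun=> 1%N)) ?sum1_card//; exact: leqW.
Qed.

Let gl_currentE (a b : I) m : a != b ->
  (gl_current a b m : V -> V) = rho (aff (sl_of_mx (delta_mx a b)) m).
Proof.
move=> ab; rewrite /gl_current /traceless_part mxtrace_delta (negPf ab) mul0r.
by rewrite raddf0 subr0.
Qed.

(** [Lambda r] vanishes on the simple coroots other than the [r]-th, so integrability applies
    through [lowering_kill]. *)
Lemma simple_kill (k : 'I_l) : k.+1 != r -> gl_current (hi k) (lo k) 0 v = 0.
Proof.
move=> kr; have hl : hi k != lo k by rewrite -val_eqE /= neq_ltn ltnSn orbT.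
have lh : lo k != hi k by rewrite eq_sym.
apply: (lowering_kill gl_current_comm lh (m := 0)).
- by apply: gl_current_upper; exact: ltnSn.
- rewrite !gl_current_diag scale0r addr0 -scalerBl.
  have -> : (hi k < r)%N = (lo k < r)%N by rewrite /= /bump; lia.
  by rewrite subrr scale0r.
have [_ _ int _ _] := std; have [_ /(_ v)[n nv]] := int (lift ord0 k).
by exists n; move: nv; rewrite /chev_f liftK -gl_currentE.
Qed.

Lemma affine_kill : (0 < r)%N -> gl_current ord0 ord_max (-1) v = 0.
Proof.
move=> r0; have M0 : ord_max != ord0 :> I by rewrite -val_eqE /= -lt0n.
apply: (lowering_kill gl_current_comm M0 (m := 1)).
- exact: gl_current_pos.
- rewrite !gl_current_diag -scalerBl /= r0 ltnNge rl /= scale1r.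
  by rewrite -[X in _ + X]scale1r -scalerDl (_ : _ + 1 = 0) ?scale0r//; ring.
have [_ _ int _ _] := std; have [_ /(_ v)[n nv]] := int ord0.
by exists n; move: nv; rewrite /chev_f unlift_none -gl_currentE// eq_sym.
Qed.

(** Such a root vector is an iterated commutator of simple lowering operators, none of them the
    [r]-th. *)
Lemma lower_kill (a b : I) : (b < a)%N -> (a < r)%N = (b < r)%N -> gl_current a b 0 v = 0.
Proof.
have [n] := ubnP (a - b)%N; elim: n a b => // n IH a b abn ba abr.
have [ab1|ab1] := eqVneq (a : nat) b.+1.
  have bl : (b < l)%N by rewrite -ltnS -ab1.
  have -> : a = hi (Ordinal bl) by apply/val_inj; rewrite /= ab1.
  rewrite [X in gl_current _ X](_ : b = lo (Ordinal bl)); last exact/val_inj.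
  by apply: simple_kill => /=; lia.
pose c : I := inord a.-1.
have cE : c = a.-1 :> nat by rewrite inordK//; have := ltn_ord a; lia.
have ac : gl_current a c 0 v = 0 by apply: IH; rewrite ?cE; lia.
have cb : gl_current c b 0 v = 0 by apply: IH; rewrite ?cE; lia.
rewrite -[0]addr0; apply: bracket_kill gl_current_comm _ ac cb.
by rewrite -val_eqE gtn_eqF.
Qed.

(** Obtained from [E_(0,max)(-1)] by brackets with [E_a0(0)] and [E_(max,b)(0)], both of which kill
    [v]. *)
Lemma negative_kill (a b : I) : (a < r)%N -> (r <= b)%N -> gl_current a b (-1) v = 0.
Proof.
move=> ar rb; have r0 : (0 < r)%N by lia.
have aM : gl_current a ord_max (-1) v = 0.
  have [->|a0] := eqVneq a ord0; first exact: affine_kill.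
  have aN0 : gl_current a ord0 0 v = 0 by apply: lower_kill; rewrite ?lt0n//= ar; lia.
  rewrite -[-1]add0r; apply: bracket_kill gl_current_comm _ aN0 (affine_kill r0).
  by rewrite -val_eqE ltn_eqF//= (leq_trans ar).
have [->//|bM] := eqVneq b ord_max.
have Mb : gl_current ord_max b 0 v = 0.
  apply: lower_kill; first by rewrite ltn_neqAle -val_eqE /= in bM *; rewrite bM -ltnS ltn_ord.
  by rewrite /=; lia.
rewrite -[-1]addr0; apply: bracket_kill gl_current_comm _ aM Mb.
by rewrite -val_eqE ltn_eqF// (leq_trans ar).
Qed.

Definition weight_cochar (a : I) : int := (a < r)%N%:Z.

(** A flowed nonnegative mode is an original mode [k >= (b < r) - (a < r)]. Besides positive modes
    this leaves [k = -1] with [a < r <= b], and [k = 0]; the constant [r/(l+1)] cancels the diagonal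
    zero modes. *)
Lemma standard_vacuum : exists s, vacuum l.+1%:R^-1
  (flow weight_cochar (r%:R / l.+1%:R) gl_current)
  (flow_d weight_cochar gl_current (rho aff_d)) s v.
Proof.
(* As [aff_d] kills [v], the eigenvalue comes only from the zero modes in [flow_d]. *)
exists (\sum_a (weight_cochar a)%:~R * ((a < r)%N%:R - r%:R / l.+1%:R)); split.
- exact/flow_comm/gl_current_comm.
- apply: flow_dP gl_current_comm _ => a b m w /=.
  by apply/eqP; rewrite -subr_eq0 opprD addrA -rho_bracket aff_bracket_d rhoZ subrr.
- have dv : rho aff_d v = 0.
    rewrite hwv_cartan ?Lambda_d ?scale0r//.
    by split=> //; apply/is_diag_mxP => i j _; rewrite mxE.
  rewrite -[LHS]/(rho aff_d v + \sum_a (weight_cochar a)%:~R *: gl_current a a 0 v).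
  rewrite dv add0r scaler_suml; apply: eq_bigr => a _.
  by rewrite gl_current_diag scalerA.
- exact: hwv_neq0.
- move=> a b m m0; rewrite flowE /weight_cochar; have [<-|ab] := eqVneq a b.
    rewrite subrK /=; have [->|m1] := eqVneq m 0.
      by rewrite gl_current_diag -scalerDl -pmulrn addrC addrA subrK subrr scale0r.
    by rewrite scale0r addr0 gl_current_pos//; lia.
  rewrite scale0r addr0; set k := _ + _.
  have [k0|] := ltP 0 k; first exact: gl_current_pos.
  have [ab1|ba1] := ltnP a b.
    have [->|kN] := eqVneq k 0; first by rewrite gl_current_upper.
    move=> kle; have -> : k = -1 by lia.
    by apply: negative_kill; lia.
  move=> kle; have ba : (b < a)%N by rewrite ltn_neqAle eq_sym ab.
  have -> : k = 0 by lia.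
  by apply: lower_kill => //; lia.
- exact: flow_irr gl_current_irr.
Qed.

(** * The basis of the Feigin-Stoyanovsky's type subspace *)

Variable x : 'I_l -> sl.
Hypothesis x_root : forall i, x i != 0 /\ root_space (gamma i) (x i).

Let c (i : 'I_l) : F := sl_mx (x i) (lo i) ord_max.

Let xE i : x i = c i *: traceless_part (delta_mx (lo i) ord_max).
Proof. by apply: root_space_gamma; have [] := x_root i. Qed.

Let c_neq0 i : c i != 0.
Proof. by have [+ _] := x_root i; apply: contra_neq => c0; rewrite xE c0 scale0r. Qed.

Let creation (j : 'I_l) (m : nat) : {linear V -> V} := rho (aff (x j) (- m%:Z)).

Let e := flow weight_cochar (r%:R / l.+1%:R) gl_current.

Let delta (j : 'I_l) : nat := (j < r)%N.

(** As [r <= l], [weight_cochar] vanishes at [ord_max], and the flow shifts the modes of colour [i]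
    by [delta i]. *)
Let gl_current_flow (i : 'I_l) m u :
  gl_current (lo i) ord_max m u = e (lo i) ord_max ((delta i)%:Z + m) u.
Proof.
rewrite /e flowE (negPf (lo_neq_max i)) scale0r addr0; congr (gl_current _ _ _ u).
by rewrite /weight_cochar /= [(l < r)%N]ltnNge rl /delta; lia.
Qed.

Let rho_affZ a (y : sl) m z : rho (aff (a *: y) m) z = a *: rho (aff y m) z.
Proof. by rewrite -[a *: y]addr0 rho_affP rho_aff0 addr0. Qed.

Let creationE j m u : creation j m u = c j *: particle e delta j m u.
Proof. by rewrite /creation [x j]xE /= rho_affZ; congr (_ *: _); exact: gl_current_flow. Qed.

Let act_creation w u : act creation w u = (\prod_(q <- w) c q.1) *: act (particle e delta) w u.
Proof.
elim: w u => [|q w IH] u /=; first by rewrite big_nil scale1r.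
by rewrite IH creationE linearZ scalerA big_cons mulrC.
Qed.

Let prod_neq0 (w : seq ('I_l * nat)) : \prod_(q <- w) c q.1 != 0.
Proof. by rewrite prodf_seq_neq0; apply/allP => q _; exact: c_neq0. Qed.

Let monomialE b : monomial_vector rho x v b = act creation (factors b) v.
Proof. exact: monomial_vector_factors. Qed.

(** Positivity and monotonicity of the modes follow from the initial and difference conditions. *)
Let admissibleP b : admissible r b <-> particle_adm delta b.
Proof.
split=> [[bo bi bd] j|badm].
  split.
    apply/(sortedP 0%N) => n nb; exact: bd.
  by apply/(all_nthP 0%N) => n nb; exact: bi.
split=> [j|j n nb|j n nb]; have [bs ba] := badm j.
- split; last by apply: sub_all ba => p /= /(leq_trans _); apply.
  by apply: sub_sorted bs => p q; lia.
- by have /(all_nthP 0%N) := ba; apply.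
- by have /(sortedP 0%N) := bs; apply.
Qed.

Lemma admissible_basis :
  is_basis_of (@admissible l r) (monomial_vector rho x v) (FS_subspace rho v).
Proof.
have [s vac] := standard_vacuum.
have ecomm := vac_comm vac.
split.
  move=> t k ut tP sum0 b bt; apply/eqP; rewrite -[_ == _]orbF -(negPf (prod_neq0 (factors b))).
  rewrite -mulf_eq0; apply/eqP.
  (* Each [x_j(-m)] is [c j] times a [particle], so the coefficients are rescaled by nonzero
     products of these scalars. *)
  apply: (particle_free (delta := delta) vac (c := fun b => k b * \prod_(q <- factors b) c q.1) ut) => //.
    by move=> b' /tP /admissibleP.
  rewrite -[RHS]sum0; apply: eq_bigr => b' _.
  by rewrite monomialE act_creation scalerA.
set W := lin_span _ _; have Wsub : subspace W by exact: lin_span_subspace.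
(* Here the relations hold exactly, so [U] is zero and every word lies in [W]. *)
have Wact w : W (act (particle e delta) w v).
  have [|||||a aS /eqP] := particle_span (Y := particle e delta) (delta := delta)
    (U := fun _ u => u = 0) (v := v) (w := w) _ (erefl _).
  - by move=> *; exact: particle_comm.
  - by move=> _; split=> // a _ _ -> ->; rewrite scaler0 addr0.
  - by move=> _ u i p ->; rewrite linear0.
  - by move=> i p pi; exact: particle_kill vac pi.
  - by move=> i j N; exact: particle_product_eq0 vac.
  rewrite subr_eq0 => /eqP ->; apply: lin_span_min aS => // b [badm _].
  have -> : act (particle e delta) (factors b) v =
      (\prod_(q <- factors b) c q.1)^-1 *: monomial_vector rho x v b.
    by rewrite monomialE act_creation scalerA mulVf ?scale1r.
  by apply: subspaceZ => //; apply: lin_span_mem; [exact/admissibleP|].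
have Wg1 u z : aff_g1 u -> W z -> W (rho u z).
  move=> [cu du ug1] Wz; have [t [ut tu]] := finite_loop u.
  rewrite (rho_decomp _ ut tu) cu du !scale0r !addr0.
  apply: subspace_sum => // m _ _; have [y [yr ->]] := ug1 m.
  have -> : \sum_i y i = \sum_i sl_mx (y i) (lo i) ord_max *: traceless_part (delta_mx (lo i) ord_max).
    by apply: eq_bigr => i _; exact: root_space_gamma.
  elim/big_ind: _ => [|y1 y2 W1 W2|i _].
  - by rewrite rho_aff0; case: Wsub.
  - by rewrite -[y1]scale1r rho_affP scale1r; exact: subspaceD.
  rewrite rho_affZ; apply: subspaceZ => //.
  have -> : rho (aff (traceless_part (delta_mx (lo i) ord_max)) m) z
    = gl_current (lo i) ord_max m z by [].
  move: z Wz; apply: (lin_span_min (W := fun z => W (gl_current (lo i) ord_max m z))).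
    split; first by rewrite linear0; case: Wsub.
    by move=> a z1 z2 Wz1 Wz2; rewrite linearP; case: Wsub => _; apply.
  move=> b _; rewrite monomialE act_creation linearZ; apply: subspaceZ => //.
  rewrite /= gl_current_flow.
  (* A positive mode commutes past the monomial and kills [v]; any other mode only lengthens the
     word. *)
  have [m0|m0] := leP m 0; last first.
    rewrite (@root_act _ _ _ _ e delta i _ _ _ ecomm) (vac_kill vac) ?linear0; first by case: Wsub.
    by lia.
  have -> : (delta i)%:Z + m = (delta i)%:Z - `|m|%N%:Z by lia.
  by have := Wact (factors b ++ [:: (i, `|m|%N)]); rewrite act_cat.
apply/seteqP; split=> z.
  apply: lin_span_min; first exact: lin_span_subspace.
  move=> b _; rewrite monomialE.
  (* In [envelope_orbit] the last element of the list acts first, hence the reversal. *)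
  apply: (@lin_span_mem _ _ _ _ _ (rev [seq aff (x q.1) (- q.2%:Z) | q <- factors b])).
    move=> u; rewrite mem_rev => /mapP[q _ ->]; split=> // m.
    exists (fun i => if (m == - q.2%:Z) && (i == q.1) then x i else 0); split=> [i|].
      case: ifP => _; first by have [] := x_root i.
      by move=> h _; rewrite sl_bracketx0 scaler0.
    rewrite /=; case: eqP => _ /=; last by rewrite big1.
    by rewrite (bigD1 q.1)//= eqxx big1 ?addr0// => i /negPf ->.
  rewrite -foldl_rev revK; elim: (factors b) v => //= q w IH u; exact: IH.
apply: lin_span_min => // t /= tg1; elim: t tg1 => [|u t IH] tg1 /=.
  exact: (Wact [::]).
apply: Wg1; first by apply: tg1; exact: mem_head.
by apply: IH => u' u't; apply: tg1; rewrite inE u't orbT.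
Qed.

End StandardModule.

Theorem theorem2 (R : realType) (l r : nat) (hl : (1 <= l)%N) (hr : (r <= l)%N)
    (V : lmodType R[i]) (rho : affine R[i] l -> V -> V) (v : V)
    (x : 'I_l -> sl R[i] l) :
  standard_module rho (@Lambda R[i] l r) v ->
  (forall i : 'I_l, x i != 0 /\ root_space (@gamma R[i] l i) (x i)) ->
  is_basis_of (@admissible l r) (monomial_vector rho x v) (FS_subspace rho v).
Proof. by move=> std xr; exact: admissible_basis. Qed.
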